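(* Let $\tau\in(0,\infty]$ and $0<\delta<1-\frac1{1+\tau}$. There exists a positively expansive topological dynamical system $(X,f)$ satisfying the non-uniform periodic $\tau$-specification property such that: (1) $\overline{\mathcal{M}_f^{co}(X)}\subsetneq\overline{\mathcal{M}_f^{erg}(X)}\subsetneq\mathcal{M}_f(X)$; (2) the exponential periodic growth rate is strictly less than the topological entropy; more precisely, $$\limsup_{n\to\infty}\frac1n\log|\mathrm{Per}_n(f)|\le\Big(\frac1{1+\tau}+\delta\Big)h_{top}(f)<h_{top}(f).$$
   Context: Convention: $\frac1{1+\infty}=0$. A topological dynamical system $(X,f)$ consists of a compact metric space $(X,d)$ with at least two points and a continuous map $f:X\to X$; $h_{top}(f)$ is topological entropy. $\mathcal{M}_f(X)$, $\mathcal{M}_f^{erg}(X)$ are the $f$-invariant, resp. $f$-ergodic, Borel probability measures, with the weak$^*$ topology. $\mathrm{Per}_n(f)=\{x\in X:f^nx=x\}$; $|S|$ denotes cardinality; $\mathcal{M}_f^{co}(X)$ is the set of periodic measures $\frac1n\sum_{k=0}^{n-1}\delta_{f^kx}$ with $x\in\mathrm{Per}_n(f)$, $n\ge1$. $f$ is positively expansive if there is $\varepsilon_0>0$ such that $x\ne y$ implies $d(f^ix,f^iy)\ge\varepsilon_0$ for some integer $i\ge0$. Non-uniform periodic specification: $(X,f)$ has the non-uniform periodic specification property with gap function $M:\mathbb{N}\times(0,\infty)\to\mathbb{N}$ ($\mathbb{N}$ the positive integers) if $M(n,\varepsilon)$ is non-decreasing in $n$ and non-increasing in $\varepsilon$,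 and for every $\varepsilon>0$, every integer $k\ge2$, all $x_1,\dots,x_k\in X$ and all non-negative integers $a_1\le b_1<a_2\le b_2<\cdots<a_k\le b_k$ with $a_{i+1}-b_i\ge M(b_i-a_i+1,\varepsilon)$ for $1\le i\le k-1$: there is $z\in X$ with $d(f^{n-a_i}x_i,f^nz)\le\varepsilon$ for all $a_i\le n\le b_i$, $1\le i\le k$; and moreover for every positive integer $p\ge b_k-a_1+M(b_k-a_k+1,\varepsilon)$ such a $z$ can be chosen with $f^pz=z$. Let $\mathscr{G}(X,f)$ be the set of all gap functions with which $(X,f)$ has the non-uniform periodic specification property, and $\tau(M)=\sup_{\varepsilon>0}\liminf_{n\to\infty}M(n,\varepsilon)/n\in[0,\infty]$. $(X,f)$ has the non-uniform periodic $\tau$-specification property if there is $M\in\mathscr{G}(X,f)$ with $\tau(M)=\tau$ and every $M'\in\mathscr{G}(X,f)$ satisfies $\tau(M')\ge\tau$. *)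

(* Defs.v *)
From HB Require Import structures.
From mathcomp Require Import all_boot all_order all_algebra.
From mathcomp Require Import all_classical all_reals all_analysis.

Set Implicit Arguments.
Unset Strict Implicit.
Unset Printing Implicit Defensive.

Import Order.TTheory GRing.Theory Num.Theory.
Import numFieldNormedType.Exports.

Local Open Scope classical_set_scope.
Local Open Scope ring_scope.

(* The distinguished point is only there because measurableType demands one;
   topological_dynamical_system makes the space nonempty anyway. *)
#[short(type="pointedMetricType")]
HB.structure Definition PointedMetric (R : numDomainType) :=
  {X of Metric R X & Pointed X}.

Section TopologicalDynamics.
Context {R : realType} {X : pointedMetricType R}.
Implicit Types (f : X -> X) (e : R) (n p : nat).

Definition topological_dynamical_system f :=
  [/\ compact [set: X], exists x y : X, x <> y & continuous f].

Definition positively_expansive f :=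
  exists2 e0 : R, 0 < e0 &
    forall x y : X, x <> y -> exists i, e0 <= mdist (iter i f x) (iter i f y).

Definition Per f n : set X := [set x | iter n f x = x].

(* Bowen's definition of topological entropy through (n, e)-separated sets;
   [counting] is the cardinality, with value +oo on infinite sets. *)
Definition separated f n e (E : set X) :=
  forall x y, E x -> E y -> x <> y ->
    exists2 i, (i < n)%N & e < mdist (iter i f x) (iter i f y).

Definition max_separated f n e : \bar R :=
  ereal_sup [set @counting X R E | E in separated f n e].

Definition htop f : \bar R :=
  lim ((limn_esup (fun n => ((n%:R)^-1)%:E * lne (max_separated f n e))%E)
         @[e --> 0^'+]).

(* [lne 0 = -oo], so the n with Per f n empty do not affect the limsup unless
   they are cofinite. *)
Definition periodic_growth_rate f : \bar R :=
  limn_esup (fun n => ((n%:R)^-1)%:E * lne (@counting X R (Per f n)))%E.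

(* A gap function is a map on {1, 2, ...} x (0, +oo) with values in
   {1, 2, ...}: its values at n = 0 or e <= 0 are irrelevant throughout. *)
Definition gap_function (M : nat -> R -> nat) :=
  [/\ forall n e, (0 < n)%N -> 0 < e -> (0 < M n e)%N,
      forall m n e, (0 < m)%N -> (m <= n)%N -> 0 < e -> (M m e <= M n e)%N &
      forall n e e', (0 < n)%N -> 0 < e -> e <= e' -> (M n e' <= M n e)%N].

(* The segments are indexed by 0, ..., k - 1, i.e. x_{i+1}, a_{i+1}, b_{i+1}
   are x i, a i, b i; values at indices i >= k play no role. *)
Definition shadows f e k (x : nat -> X) (a b : nat -> nat) (z : X) :=
  forall i n, (i < k)%N -> (a i <= n <= b i)%N ->
    mdist (iter (n - a i) f (x i)) (iter n f z) <= e.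

Definition nonuniform_periodic_specification f (M : nat -> R -> nat) :=
  gap_function M /\
  forall e, 0 < e -> forall k, (2 <= k)%N ->
  forall (x : nat -> X) (a b : nat -> nat),
    (forall i, (i < k)%N -> (a i <= b i)%N) ->
    (forall i, (i.+1 < k)%N -> (b i < a i.+1)%N) ->
    (forall i, (i.+1 < k)%N -> (M (b i - a i).+1 e <= a i.+1 - b i)%N) ->
    (exists z, shadows f e k x a b z) /\
    (forall p, (0 < p)%N ->
       (b k.-1 - a 0 + M (b k.-1 - a k.-1).+1 e <= p)%N ->
       exists2 z, shadows f e k x a b z & iter p f z = z).

Definition gap_rate (M : nat -> R -> nat) : \bar R :=
  ereal_sup [set limn_einf (fun n => ((M n e)%:R / n%:R)%:E)
            | e in [set e : R | 0 < e]].

Definition nonuniform_periodic_tau_specification f (tau : \bar R) :=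
  (exists2 M, nonuniform_periodic_specification f M & gap_rate M = tau) /\
  (forall M', nonuniform_periodic_specification f M' ->
     (tau <= gap_rate M')%E).

End TopologicalDynamics.

Section InvariantMeasures.
Context {R : realType} (X : pointedMetricType R).

Definition borel := g_sigma_algebraType (@open X).

Definition integrals (mu : probability borel R) :
    prod_topology (fun _ : continuousType X R => R) :=
  fun g => Rintegral mu [set: borel] g.

(* Borel probability measures with the weak* topology: the coarsest topology
   for which mu |-> \int g dmu is continuous for all continuous g : X -> R.
   A [probability] is a function on all subsets of X, so two of them may agree
   on the Borel sets without being equal; every set of measures below, and
   every weak* closure, only depends on the values on Borel sets. *)
Definition borel_probability := initial_topology integrals.

Context (f : X -> X).

Definition invariant_measures : set borel_probability :=
  [set mu : probability borel R |
    forall A : set borel, measurable A -> mu (f @^-1` A) = mu A].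

Definition ergodic_measures : set borel_probability :=
  [set mu : probability borel R | invariant_measures mu /\
    forall A : set borel, measurable A -> f @^-1` A = A ->
      mu A = 0%E \/ mu A = 1%E].

Definition periodic_measures : set borel_probability :=
  [set mu : probability borel R | exists n (x : X), [/\ (0 < n)%N, Per f n x &
    forall A : set borel, measurable A ->
      mu A = (((n%:R)^-1)%:E * \sum_(k < n) \d_(iter k f x : borel) A)%E]].

End InvariantMeasures.

(* Main.v *)
Require Import Defs.
From HB Require Import structures.
From mathcomp Require Import all_boot all_order all_algebra.
From mathcomp Require Import all_classical all_reals all_analysis.
From mathcomp Require Import measurable_realfun zify ring lra.

(* The example is the one-sided subshift of all sequences over a blank symbol
   None and finitely many letters in which a finite block of n letters is
   followed by at least g n blanks, where g n grows like tau n (quadratically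
   if tau = +oo), and in which no block of letters looks periodic. A piece of
   orbit of length n can be cut and followed by blanks, which costs a gap of
   about g n; conversely a periodic point shadowing two long blocks must
   contain blanks, so smaller gaps are impossible. Along a periodic orbit the
   letters have frequency at most 1 / (1 + tau), whereas blank-free points
   already have almost maximal entropy; a large alphabet makes all
   combinatorial losses smaller than delta. By invariance the same bound on the
   frequency of letters holds for every ergodic measure not carried by the
   blank-free points. Such a blank-free ergodic measure, the image of Haar
   measure on the 2-adic integers, is hence not a limit of periodic measures,
   and its mixtures with the Dirac mass at the blank point are not all limits
   of ergodic measures. *)

Set Implicit Arguments.
Unset Strict Implicit.
Unset Printing Implicit Defensive.

Import Order.TTheory GRing.Theory Num.Theory.
Import numFieldNormedType.Exports.

Local Open Scope classical_set_scope.
Local Open Scope ring_scope.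

(** * Admissible sequences *)

(** The Boolean component carries an aperiodic code; the other component is free and supplies the
    entropy [ln b.+1]. *)
Definition letter (b : nat) : finType := option (bool * 'I_b.+1).

Section AdmissibleSequences.
Local Open Scope nat_scope.
Context {b : nat} (g : nat -> nat).
Implicit Types (x y z : nat -> letter b) (s n m p j : nat).

Definition block x s n := forall t, t < n -> isSome (x (s + t)).

(* The window of length 4 p is what the ruler sequence below satisfies. *)
Record admissible x : Prop := Admissible {
  admissible_gap : forall s n j, 0 < n -> block x s n ->
    x (s + n) = None -> j < g n -> x (s + n + j) = None;
  admissible_aperiodic : forall s p, 0 < p -> block x s (5 * p) ->
    exists2 j, j < 4 * p & x (s + j) <> x (s + j + p) }.

Lemma admissible_shift m x :
  admissible x -> admissible (fun n => x (m + n)).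
Proof.
case=> xg xa; split=> [s n j n0 xb|s p p0 xb].
  rewrite !addnA => xn jg.
  by apply: xg n0 _ xn jg => t tn; rewrite -addnA; exact: xb.
have [|j j4 xj] := xa (m + s) p p0.
  by move=> t tp; rewrite -addnA; exact: xb.
by exists j => //; rewrite -!addnA in xj *.
Qed.

Lemma admissible_none : admissible (fun=> None).
Proof.
split=> // s p p0 xb; have /= := xb 0.
by rewrite muln_gt0 p0 => /(_ isT).
Qed.

Hypothesis g_mono : {homo g : m n / m <= n}.

(** Both conditions concern a single block. A block of [z] starting at [m] has length at most [h],
    because [z] is blank at [m + h], so it is a block of [y]. The blanks due after it either lie
    inside [y] or among those following [m + h], enough of them since [g] is monotone. *)
Lemma admissible_local z :
  (forall m, isSome (z m) -> exists h y, [/\ admissible y,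
     forall t, t < h -> z (m + t) = y t &
     forall t, t <= g h -> z (m + h + t) = None]) ->
  admissible z.
Proof.
move=> loc.
have blockP s n : 0 < n -> block z s n -> exists h y, [/\ n <= h,
     admissible y, forall t, t < h -> z (s + t) = y t &
     forall t, t <= g h -> z (s + h + t) = None].
  move=> n0 zb.
  have [|h [y [yadm zy z0]]] := loc s; first by have := zb 0 n0; rewrite addn0.
  exists h, y; split=> //; rewrite leqNgt; apply/negP => hn.
  by have := zb h hn; have := z0 0 isT; rewrite addn0 => ->.
split=> [s n j n0 zb zn jg|s p p0 zb].
  have [h [y [nh yadm zy z0]]] := blockP s n n0 zb.
  have [njh|hnj] := ltnP (n + j) h.
    rewrite -addnA zy//; apply: (admissible_gap (s := 0) yadm n0) => //.
      by move=> t tn; rewrite add0n -zy ?zb//; lia.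
    by rewrite add0n -zy//; lia.
  rewrite (_ : s + n + j = s + h + (n + j - h)); last by lia.
  by apply: z0; have := g_mono nh; lia.
have [h [y [nh yadm zy z0]]] := blockP s _ (ltac:(lia) : 0 < 5 * p) zb.
have [|j j4 yj] := admissible_aperiodic (s := 0) yadm p0.
  by move=> t tn; rewrite add0n -zy ?zb//; lia.
exists j => //; rewrite -addnA !zy; try lia.
by move: yj; rewrite !add0n.
Qed.

(** Copy each [x i] on its segment, put blanks elsewhere and repeat with period [p]. A block begun
    inside a segment is cut at the latest at [hi i], where enough blanks follow; the last hypothesis
    provides them before the first segment recurs. *)
Lemma admissible_gluing k (x : nat -> nat -> letter b) (lo hi : nat -> nat) p :
  0 < k -> (forall i, i < k -> admissible (x i)) ->
  (forall i, i < k -> lo i < hi i) ->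
  (forall i, i.+1 < k -> hi i + g (hi i - lo i) < lo i.+1) ->
  hi k.-1 + g (hi k.-1 - lo k.-1) < lo 0 + p ->
  exists z, [/\ admissible z,
    forall i n, i < k -> lo i <= n < hi i -> z n = x i (n - lo i) &
    forall n, z (p + n) = z n].
Proof.
move=> k0 xadm lohi gap wrap.
have hilo i i' : i < i' -> i' < k -> hi i + g (hi i - lo i) < lo i'.
  elim: i' => // i' IH; rewrite ltnS leq_eqVlt => /orP[/eqP<-|ii'] i'k.
    exact: gap.
  have := IH ii' (ltnW i'k); have := gap _ i'k; have := lohi i' (ltnW i'k); lia.
have lo0 i : i < k -> lo 0 <= lo i.
  case: i => // i ik; have := hilo 0 i.+1 isT ik; have := lohi 0 k0; lia.
have hi_wrap i : i < k -> hi i + g (hi i - lo i) < lo 0 + p.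
  move=> ik; have [iltk|] := ltnP i k.-1.
    have kk : k.-1 < k by lia.
    by have := hilo _ _ iltk kk; have := lohi _ kk; lia.
  by move=> ki; rewrite (_ : i = k.-1) //; lia.
have p0 : 0 < p by have := hi_wrap 0 k0; have := lohi 0 k0; lia.
pose z0 n : letter b := if [pick i : 'I_k | lo i <= n < hi i] is Some i
                        then x i (n - lo i) else None.
have z0x i n : i < k -> lo i <= n < hi i -> z0 n = x i (n - lo i).
  move=> ik nI; rewrite /z0; case: pickP => [j jI|/(_ (Ordinal ik))]; last first.
    by rewrite nI.
  suff -> : i = j by [].
  have [ij|ji|//] := ltngtP i j.
    by have := hilo _ _ ij (ltn_ord j); lia.
  by have := hilo _ _ ji ik; lia.
have z0none i n : i < k -> hi i <= n <= hi i + g (hi i - lo i) -> z0 n = None.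
  move=> ik nI; rewrite /z0; case: pickP => // j jI.
  have [ij|ji|ij] := ltngtP i j; last by move: nI; rewrite ij; lia.
    by have := hilo _ _ ij (ltn_ord j); lia.
  by have := hilo _ _ ji ik; have := lohi i ik; lia.
have z0some n : isSome (z0 n) -> exists2 i, i < k & lo i <= n < hi i.
  by rewrite /z0; case: pickP => // i iI _; exists i.
(* [w] repeats the window of [z0] from [lo 0] to [lo 0 + p]. *)
pose w q := z0 (lo 0 + q %% p).
have wadm : admissible w.
  apply: admissible_local => m /z0some[i ik iI].
  set r := lo 0 + m %% p in iI.
  have wr t : r + t < lo 0 + p -> w (m + t) = z0 (r + t).
    move=> rt; rewrite /w -modnDml modn_small /r ?addnA//.
    by move: rt; rewrite /r; lia.
  have hw := hi_wrap i ik.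
  exists (hi i - r), (fun n => x i (r - lo i + n)); split.
  - by apply: admissible_shift; exact: xadm.
  - move=> t tlt; rewrite wr; last by lia.
    by rewrite (z0x i)//; [congr (x i _)|]; lia.
  - move=> t tlt.
    have gle : g (hi i - r) <= g (hi i - lo i) by apply: g_mono; lia.
    rewrite -addnA wr; last by lia.
    by rewrite (z0none i)//; lia.
(* The shift by [lo 0 * p.-1], which is [- lo 0] modulo [p], moves the window back to its place. *)
exists (fun n => w (lo 0 * p.-1 + n)); split; first exact: admissible_shift.
  move=> i n ik iI; rewrite -(z0x i n ik iI) /w; congr z0.
  have l0 := lo0 i ik; have hw := hi_wrap i ik.
  rewrite (_ : lo 0 * p.-1 + n = lo 0 * p + (n - lo 0)).
    by rewrite modnMDl modn_small//; lia.
  by case: (p) p0 => // q _ /=; rewrite mulnS; lia.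
by move=> n; rewrite /w addnCA modnDl.
Qed.

(** The first blank after the block ends a block of length at least [n], hence starts a run of at
    least [g n] blanks, and the letter at [s + n + l] lies beyond that run. *)
Lemma admissible_zero_gap z s n l i : admissible z -> block z s n -> 0 < n ->
  isSome (z (s + n + l)) -> i < l -> z (s + n + i) = None -> g n <= l.
Proof.
move=> zadm zb n0 zl il zi.
have ex0 : exists i, ~~ isSome (z (s + n + i)) by exists i; rewrite zi.
pose j := ex_minn ex0; have jP := ex_minnP ex0.
have {jP}[zj jmin] : ~~ isSome (z (s + n + j)) /\
    forall i, ~~ isSome (z (s + n + i)) -> j <= i by rewrite /j; case: jP.
have ji : j <= i by apply: jmin; rewrite zi.
have nj : g n <= g (n + j) by apply: g_mono; lia.
rewrite leqNgt; apply/negP => lg.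
suff : z (s + (n + j) + (l - j)) = None.
  by rewrite (_ : s + (n + j) + (l - j) = s + n + l); [case: (z _) zl | lia].
apply: (admissible_gap zadm); [lia| |by rewrite addnA; case: (z _) zj|lia].
move=> t tn; have [/zb//|nt] := ltnP t n.
rewrite (_ : s + t = s + n + (t - n)); last by lia.
by apply/negPn/negP => /jmin; lia.
Qed.

(** A blank-free sequence of period [p] would contradict aperiodicity for this very [p]. *)
Lemma admissible_periodic_none z p : admissible z -> 0 < p ->
  (forall n, z (p + n) = z n) -> exists n, z n = None.
Proof.
move=> zadm p0 zp.
have [/existsP[i zi]|/existsPn zs] := boolP [exists i : 'I_(5 * p), ~~ isSome (z i)].
  by exists i; case: (z i) zi.
have [|j _] := admissible_aperiodic (s := 0) zadm p0.
  by move=> t tp; rewrite add0n; have /negPn := zs (Ordinal tp).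
by rewrite add0n addnC zp.
Qed.

(* A periodic point cannot avoid the symbol None, so one of the two gaps
   contains it, hence a whole run of length g n. *)
Lemma admissible_periodic_gap z n l : admissible z -> 0 < n ->
  (forall t, z ((n + l).*2 + t) = z t) ->
  block z 0 n -> block z (n + l) n -> g n <= l.
Proof.
move=> zadm n0 zp zb0 zb1.
have p0 : 0 < (n + l).*2 by rewrite double_gt0 addn_gt0 n0.
have [q zq] := admissible_periodic_none zadm p0 zp.
have {q zq}[q [qp zq]] : exists q, q < (n + l).*2 /\ z q = None.
  exists (q %% (n + l).*2); split; first by rewrite ltn_mod.
  have zpm k t : z (k * (n + l).*2 + t) = z t.
    by elim: k => // k IH; rewrite mulSn -addnA zp.
  by rewrite -(zpm (q %/ (n + l).*2)) -divn_eq.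
have zq1 t : t < n -> q <> t by move=> /zb0 + qt; rewrite -qt add0n zq.
have zq2 t : t < n -> q <> n + l + t by move=> /zb1 + qt; rewrite -qt zq.
have nq : n <= q by rewrite leqNgt; apply/negP => /zq1.
have [qnl|nlq] := ltnP q (n + l).
  apply: (admissible_zero_gap (i := q - n) zadm zb0 n0).
  - by rewrite add0n -(addn0 (n + l)); exact: zb1.
  - by lia.
  - by rewrite -zq; congr z; lia.
have nq' : n <= q - (n + l).
  by rewrite leqNgt; apply/negP => /zq2; lia.
apply: (admissible_zero_gap (i := q - (n + l) - n) zadm zb1 n0).
- rewrite (_ : n + l + n + l = (n + l).*2 + 0); last by lia.
  by rewrite zp; exact: (zb0 0).
- by lia.
- by rewrite -zq; congr z; lia.
Qed.

(** Counting only letters with a blank fewer than [L] positions ahead leaves out infinite blocks and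
    keeps boundary effects bounded. For large [L] all letters of a periodic admissible sequence are
    counted. *)
Definition closing L x i :=
  isSome (x i) && [exists l : 'I_L, ~~ isSome (x (i + l))].

Let closings L x n := \sum_(i < n) closing L x i.
Let zeros x n := \sum_(i < n) ~~ isSome (x i).

Let closingsD L x m n :
  closings L x (m + n) = closings L x m + closings L (fun i => x (m + i)) n.
Proof.
rewrite /closings big_split_ord/=; congr (_ + _).
apply: eq_bigr => i _; congr (nat_of_bool (_ && _)).
by apply: eq_existsb => l; rewrite addnA.
Qed.

Let zerosD x m n : zeros x (m + n) = zeros x m + zeros (fun i => x (m + i)) n.
Proof. by rewrite /zeros big_split_ord. Qed.

(** Read from left to right: a closing letter whose next blank is [h] positions ahead, [h <= L],
    allows a jump of [h + g h] positions, with at most [h] closing letters and exactly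
    [g h >= kappa * h] blanks. The surplus [L + g L] on the right makes room for the last jump. *)
Lemma admissible_closing (R : realDomainType) (kappa : R) L x n :
  (forall n, kappa * n%:R <= (g n)%:R)%R -> (0 <= kappa)%R -> admissible x ->
  (kappa * (\sum_(i < n) closing L x i)%:R <=
    (\sum_(i < n + (L + g L)) ~~ isSome (x i))%:R)%R.
Proof.
move=> gk k0; rewrite -/(closings L x n) -/(zeros _ _).
elim/ltn_ind: n x => -[|n] IH x xadm.
  by rewrite /closings big_ord0 mulr0 ler0n.
have := IH n (leqnn _) _ (admissible_shift 1 xadm).
have [x0|] := boolP (closing L x 0); last first.
  move=> /negbTE x0; rewrite -[n.+1]add1n closingsD -addnA (zerosD x 1).
  rewrite {2}/closings big_ord1 x0 add0n => /le_trans; apply.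
  by rewrite ler_nat leq_addl.
case/andP: x0 => x0 /existsP[l0 xl0] _.
have ex0 : exists i, ~~ isSome (x i) by exists l0.
pose h := ex_minn ex0; have hP := ex_minnP ex0.
have {hP}[xh hmin] : ~~ isSome (x h) /\ forall i, ~~ isSome (x i) -> h <= i.
  by rewrite /h; case: hP.
have hL : h <= L by have := hmin _ xl0; have := ltn_ord l0; lia.
have h0 : 0 < h by rewrite lt0n; apply: contraNneq xh => ->.
have xb t : t < h -> isSome (x (0 + t)).
  by rewrite add0n => th; apply/negPn/negP => /hmin; lia.
have xz t : t < g h -> x (h + t) = None.
  move=> th; apply: (admissible_gap (s := 0) xadm h0 xb _ th).
  by rewrite add0n; case: (x h) xh.
have ch : closings L x (h + g h) <= h.
  rewrite closingsD -[leqRHS]addn0 leq_add//.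
    by rewrite /closings -[leqRHS]muln1 -[X in _ <= X * _]card_ord -sum_nat_const
         leq_sum// => i _; case: closing.
  by rewrite leqn0 /closings big1// => i _; rewrite /closing xz.
have zh : zeros x (h + g h) = g h.
  rewrite zerosD {1}/zeros big1 ?add0n => [|i _]; last first.
    by have := xb i (ltn_ord i); rewrite add0n => ->.
  rewrite /zeros (eq_bigr (fun=> 1)) ?sum1_card ?card_ord// => i _.
  by rewrite xz.
have gh : g h <= g L by exact: g_mono.
have [nle|nlt] := leqP n.+1 (h + g h).
  have -> : n.+1 + (L + g L) = h + g h + (n.+1 + (L + g L) - (h + g h)) by lia.
  have := closingsD L x n.+1 (h + g h - n.+1); rewrite subnKC// => cE.
  rewrite (le_trans (y := (kappa * h%:R)%R))// ?ler_wpM2l ?ler_nat//; first by lia.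
  by rewrite (le_trans (gk h))// ler_nat zerosD zh leq_addr.
have [n' nE] : exists n', n.+1 = h + g h + n'.
  by exists (n.+1 - (h + g h)); lia.
have := IH n' (ltac:(lia)) _ (admissible_shift (h + g h) xadm) => H.
rewrite nE closingsD -(addnA (h + g h)) zerosD zh !natrD mulrDr.
rewrite lerD ?H// (le_trans _ (gk h))//.
by rewrite ler_wpM2l// ler_nat.
Qed.

(** Over [m] periods [admissible_closing] gives the inequality up to an error independent of [m]; a
    failure over one period would be multiplied by [m] and exceed that error. *)
Lemma admissible_periodic_frequency (R : archiRealFieldType) (kappa : R) x p :
  (forall n, kappa * n%:R <= (g n)%:R)%R -> (0 <= kappa)%R -> admissible x ->
  (forall n, x (p + n) = x n) ->
  (kappa * (\sum_(i < p) isSome (x i))%:R <= (\sum_(i < p) ~~ isSome (x i))%:R)%R.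
Proof.
move=> gk k0 xadm xp.
have [->|p0] := posnP p; first by rewrite !big_ord0 mulr0.
have [q xq] := admissible_periodic_none xadm p0 xp.
have sumM (F : letter b -> nat) m :
    \sum_(i < m * p) F (x i) = m * \sum_(i < p) F (x i).
  elim: m => [|m IH]; first by rewrite mul0n big_ord0.
  rewrite mulSn big_split_ord/= mulSn -IH; congr (_ + _).
  by apply: eq_bigr => i _; rewrite xp.
set L := (q + p).+1.
have cE i : closing L x i = isSome (x i).
  rewrite /closing; case: (isSome (x i)) => //=; apply/existsP.
  (* [q + i * p.-1] is [q - i] modulo [p], so this distance leads from [i] to a translate of the
     blank at [q]. *)
  have lL : (q + i * p.-1) %% p < L.
    by rewrite (leq_trans (ltn_pmod _ p0))// /L; lia.
  exists (Ordinal lL) => /=.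
  have xpm k t : x (k * p + t) = x t.
    by elim: k => // k IH; rewrite mulSn -addnA xp.
  rewrite -(xpm ((q + i * p.-1) %/ p)) addnCA -divn_eq.
  rewrite (_ : i + _ = i * p + q) ?xpm ?xq//.
  by case: (p) p0 => // p' _; rewrite mulnS /=; lia.
rewrite leNgt; apply/negP => lt.
set c := (X in (kappa * X%:R)%R) in lt; set d := (X in (X%:R < _)%R) in lt.
pose e : R := (kappa * c%:R - d%:R)%R.
have e0 : (0 < e)%R by rewrite /e subr_gt0.
pose K := L + g L.
pose m := Num.bound (K%:R / e)%R.
have mK : (K%:R < m%:R * e)%R.
  by rewrite -ltr_pdivrMr// archi_boundP// divr_ge0// ltW.
have := admissible_closing L (m * p) gk k0 xadm.
rewrite (eq_bigr (fun i : 'I__ => nat_of_bool (isSome (x i)))); last first.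
  by move=> i _; rewrite cE.
rewrite (sumM (fun a => isSome a)) big_split_ord/= (sumM (fun a => ~~ isSome a)).
rewrite -/c -/d -/K leNgt => /negP; apply.
have dK : \sum_(i < K) ~~ isSome (x (m * p + i)) <= K.
  rewrite -[leqRHS]muln1 -[X in _ <= X * _]card_ord -sum_nat_const.
  by rewrite leq_sum// => i _; case: isSome.
rewrite (@le_lt_trans _ _ (m * d + K)%:R%R)// ?ler_nat ?leq_add2l//.
by rewrite natrD !natrM [ltRHS]mulrCA addrC -ltrBrDr -mulrBr.
Qed.

(** The sum factors over the positions. Each factor is 3: weight 1 for the blank, and [1 / (b + 1)]
    for each of the [2 (b + 1)] letters. *)
Lemma sum_word_weight (R : numFieldType) n :
  (\sum_(w : {ffun 'I_n -> letter b})
     \prod_(i < n) (if isSome (w i) then b.+1%:R^-1 else 1) = 3%:R ^+ n :> R)%R.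
Proof.
rewrite -(bigA_distr_bigA (fun _ a => if isSome a then b.+1%:R^-1 else 1)%R)/=.
rewrite prodr_const card_ord; congr (_ ^+ _)%R.
rewrite (bigD1 None)//= (eq_bigr (fun=> b.+1%:R^-1)%R) => [|[]//].
rewrite sumr_const.
have -> : #|[pred i : letter b | i != None]| = 2 * b.+1.
  by rewrite cardC1 card_option card_prod card_bool card_ord.
by rewrite -[X in (_ + X)%R]mulr_natr natrM mulrCA mulVf ?pnatr_eq0// mulr1.
Qed.

End AdmissibleSequences.

(** * The subshift and its specification property *)

Section SequenceDistance.
Context {R : realType} {T : eqType}.
Implicit Types (x y z : nat -> T) (n : nat).

Definition agree n x y := forall i, (i < n)%N -> x i = y i.

(** With first disagreement at [n] giving distance [1 / (n + 1)], the closed balls of radius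
    [1 / (n + 1)] are the cylinders of length [n]. *)
Definition seq_dist x y : R :=
  if pselect (exists n, x n != y n) is left ex then (ex_minn ex).+1%:R^-1 else 0.

Lemma seq_dist_le n x y : seq_dist x y <= n.+1%:R^-1 <-> agree n x y.
Proof.
rewrite /seq_dist; case: pselect => [ex|nex].
  case: ex_minnP => m xm mmin; rewrite lef_pV2 ?posrE ?ltr0n// ler_nat ltnS; split.
    move=> nm i im; apply/eqP; apply: contraTT im => /mmin.
    by rewrite -leqNgt; apply: leq_trans.
  by move=> xy; rewrite leqNgt; apply: contra xm => /xy ->.
split=> [_ i _|_]; last by rewrite invr_ge0 ler0n.
by apply/eqP; apply: contra_notT nex => ?; exists i.
Qed.

Lemma seq_distP x y : seq_dist x y = 0 \/ exists n, seq_dist x y = n.+1%:R^-1.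
Proof.
by rewrite /seq_dist; case: pselect => [ex|_]; [right; exists (ex_minn ex)|left].
Qed.

Lemma seq_distxx x : seq_dist x x = 0.
Proof.
rewrite /seq_dist; case: pselect => // -[n xn].
by exfalso; move: xn; rewrite eqxx.
Qed.

Lemma seq_dist_eq0 x y : seq_dist x y = 0 -> x = y.
Proof.
move=> xy; apply/funext => n.
by have [+ _] := seq_dist_le n.+1 x y; apply => //; rewrite xy invr_ge0.
Qed.

Lemma seq_dist_sym x y : seq_dist x y = seq_dist y x.
Proof.
have le u v : seq_dist u v <= seq_dist v u.
  have [/[dup] vu /seq_dist_eq0 ->|[n vu]] := seq_distP v u.
    by rewrite seq_distxx.
  rewrite vu; apply/seq_dist_le => i ni; apply/esym.
  by have [+ _] := seq_dist_le n v u; apply; rewrite ?vu.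
by apply/eqP; rewrite eq_le !le.
Qed.

Lemma seq_dist_triangle y x z : seq_dist x z <= seq_dist x y + seq_dist y z.
Proof.
have ge0 u v : 0 <= seq_dist u v.
  by have [->//|[n ->]] := seq_distP u v; rewrite invr_ge0 ler0n.
have [/seq_dist_eq0 ->|[n xy]] := seq_distP x y; first by rewrite lerDr.
have [/seq_dist_eq0 <-|[m yz]] := seq_distP y z; first by rewrite lerDl.
have nm : seq_dist x z <= (minn n m).+1%:R^-1.
  apply/seq_dist_le => i; rewrite leq_min => /andP[ni mi].
  have [/(_ _ i ni) -> //] := seq_dist_le n x y; last by rewrite xy.
  by have [/(_ _ i mi) -> //] := seq_dist_le m y z; rewrite yz.
rewrite (le_trans nm)// /minn; case: ifP => _.
  by rewrite xy lerDl.
by rewrite yz lerDr.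
Qed.

End SequenceDistance.

(** The parameter [R] fixes the field in which the metric put on this type takes its values. *)
Definition gap_shift (R : realType) (g : nat -> nat) (b : nat) : Type :=
  {x : nat -> letter b | admissible g x}.

Section GapShift.
Context {R : realType} {g : nat -> nat} {b : nat}.
Local Notation X := (gap_shift R g b).
Implicit Types (x y z : X).

Definition coordinates (x : X) : nat -> letter b := sval x.

Lemma coordinatesP x : admissible g (coordinates x).
Proof. exact: (proj2_sig x). Qed.

Lemma coordinates_inj : injective coordinates.
Proof.
move=> [x xP] [y yP]; rewrite /coordinates/= => xy; subst y; congr exist.
exact: Prop_irrelevance.
Qed.

Definition all_none : X := exist _ _ (admissible_none g).

Let shift_dist x y : R := seq_dist (coordinates x) (coordinates y).

HB.instance Definition _ := gen_eqMixin X.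
HB.instance Definition _ := gen_choiceMixin X.
HB.instance Definition _ := isPointed.Build X all_none.
HB.instance Definition _ := @isMetric.Build R X shift_dist
  (fun x => seq_distxx _) (fun x y xy => coordinates_inj (seq_dist_eq0 xy))
  (fun x y => seq_dist_sym _ _) (fun y x z => seq_dist_triangle _ _ _).

Lemma mdist_agree n x y :
  mdist x y <= n.+1%:R^-1 <-> agree n (coordinates x) (coordinates y).
Proof. exact: seq_dist_le. Qed.

Lemma nbhs_agree x (A : set X) : nbhs x A <->
  exists n, forall y, agree n (coordinates x) (coordinates y) -> A y.
Proof.
split=> [/nbhs_ballP[e /= e0 eA]|[n nA]].
  exists (Num.bound e^-1) => y /mdist_agree xy; apply: eA.
  rewrite ballEmdist/=; apply: le_lt_trans xy _.
  rewrite invf_plt ?posrE ?ltr0n//.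
  by rewrite (lt_trans (archi_boundP _))// ?invr_ge0 ?ltW// ltr_nat.
apply/nbhs_ballP; exists n.+1%:R^-1 => /=; first by rewrite invr_gt0 ltr0n.
by move=> y; rewrite ballEmdist/= => /ltW/mdist_agree; exact: nA.
Qed.

(** Along an ultrafilter each coordinate is eventually constant, as the alphabet is finite. The
    limit is admissible because every instance of the two conditions involves finitely many
    coordinates. *)
Lemma compact_gap_shift : compact [set: X].
Proof.
rewrite compact_ultra => F FU _.
have /boolp.choice[y Fy] n : exists a, F [set x | coordinates x n = a].
  have [//|nF] := pselect (exists a, F [set x | coordinates x n = a]).
  have : \forall x \near F, forall a, coordinates x n != a.
    apply: filter_forall => a.
    have [Fa|] := in_ultra_setVsetC [set x | coordinates x n = a] FU.
      by exfalso; apply: nF; exists a.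
    by apply: filterS => x /= /eqP.
  by move=> /filter_ex[x] /(_ (coordinates x n)); rewrite eqxx.
have Fagree n : F [set x | agree n y (coordinates x)].
  elim: n => [|n IH]; first by apply: filterS filterT => x _ i.
  apply: filterS2 IH (Fy n) => x xn xyn i.
  by rewrite ltnS leq_eqVlt => /orP[/eqP ->//|]; exact: xn.
have yadm : admissible g y.
  split=> [s n j n0 yb yn jn|s p p0 yb].
    have [x /= xy] := filter_ex (Fagree (s + n + j).+1).
    rewrite xy//; apply: (admissible_gap (coordinatesP x) n0) => //.
      by move=> t tn; rewrite -xy ?yb//; lia.
    by rewrite -xy//; lia.
  have [x /= xy] := filter_ex (Fagree (s + 5 * p)%N).
  have [|j j4 xj] := admissible_aperiodic (s := s) (coordinatesP x) p0.
    by move=> t tn; rewrite -xy ?yb//; lia.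
  by exists j => //; rewrite !xy//; lia.
exists (exist _ y yadm); split=> // A /nbhs_agree[n nA].
by apply: filterS (Fagree n) => x /nA.
Qed.

Definition left_shift x : X := exist _ _ (admissible_shift 1 (coordinatesP x)).

Lemma iter_shiftE n x i : coordinates (iter n left_shift x) i = coordinates x (n + i).
Proof.
elim: n i => // n IH i.
by rewrite [LHS](IH (1 + i)%N) addnA addn1.
Qed.

Lemma continuous_left_shift : continuous left_shift.
Proof.
move=> x A /nbhs_agree[n nA]; apply/nbhs_agree; exists n.+1 => y xy.
by apply: nA => i ni; apply: xy; rewrite ltnS.
Qed.

(** Such points are at distance 1. The scale [2^-1] reads off the symbol at index 0, and serves for
    expansivity, entropy and the lower bound on gaps. *)
Lemma mdist_gt_half x y : coordinates x 0 <> coordinates y 0 -> 2^-1 < mdist x y.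
Proof.
move=> xy; rewrite ltNge; apply/negP => /(mdist_agree 1) xy1.
by apply: xy; exact: xy1.
Qed.

Lemma positively_expansive_left_shift : positively_expansive left_shift.
Proof.
exists 2^-1 => // x y xy.
have [i xyi] : exists i, coordinates x i <> coordinates y i.
  apply/existsNP => xyE; apply: xy; apply: coordinates_inj; exact/funext.
exists i; apply/ltW/mdist_gt_half; by rewrite !iter_shiftE addn0.
Qed.

Definition resolution (e : R) : nat := (Num.truncn e^-1).+1.

Lemma agree_resolution e x y : 0 < e ->
  agree (resolution e) (coordinates x) (coordinates y) -> mdist x y <= e.
Proof.
move=> e0 /mdist_agree /le_trans; apply; rewrite invf_ple ?posrE ?ltr0n//.
by rewrite (le_trans (ltW (truncnS_gt _)))// ler_nat.
Qed.

Lemma resolution_anti e e' : 0 < e -> e <= e' -> (resolution e' <= resolution e)%N.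
Proof.
move=> e0 ee'; rewrite ltnS le_truncn// lef_pV2// posrE.
exact: lt_le_trans ee'.
Qed.

(** With [N = resolution e], shadowing [n] steps to precision [e] means copying [n + N - 1] symbols.
    The gap has to hold the copied symbols beyond the segment and then the blanks they require. *)
Definition gap_bound n (e : R) : nat := (g (n + resolution e) + resolution e).+1.

Hypothesis g_mono : {homo g : m n / (m <= n)%N}.

Lemma gap_shift_specification : nonuniform_periodic_specification left_shift gap_bound.
Proof.
split.
  split=> // [m n e m0 mn e0|n e e' n0 e0 ee'].
    by rewrite ltnS leq_add2r g_mono// leq_add2r.
  have ree' := resolution_anti e0 ee'.
  by rewrite ltnS leq_add// g_mono// leq_add2l.
move=> e e0 k k2 x a b' ab ba gap; set N := resolution e.
have N0 : (0 < N)%N by [].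
(* The statement without periodicity follows by taking the least allowed period. *)
have periodic p : (b' k.-1 - a 0 + gap_bound (b' k.-1 - a k.-1).+1 e <= p)%N ->
    exists2 z, shadows left_shift e k x a b' z & iter p left_shift z = z.
  have gN m n : (m <= n)%N -> (g (n - m + N) <= g ((n - m).+1 + N))%N.
    by move=> mn; apply: g_mono; rewrite leq_add2r.
  move=> bp; have [|||||z [zadm zx zp]] := @admissible_gluing b g g_mono k
      (fun i => coordinates (x i)) a (fun i => b' i + N)%N p.
  - by lia.
  - by move=> i _; exact: coordinatesP.
  - by move=> i ik; have := ab i ik; lia.
  - move=> i ik; have := gap i ik; have := ab i (ltnW ik); rewrite /gap_bound -/N.
    move=> abi; rewrite (_ : b' i + N - a i = b' i - a i + N)%N; last by lia.
    by have := gN _ _ abi; have := ba i ik; lia.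
  - have k1 : (k.-1 < k)%N by lia.
    have a0 j : (j < k)%N -> (a 0 <= a j)%N.
      elim: j => // j IH jk; have := IH (ltnW jk); have := ba j jk.
      have := ab j (ltnW jk); lia.
    have := ab _ k1; have := a0 _ k1; move: bp; rewrite /gap_bound -/N => bp a0k abk.
    rewrite (_ : b' k.-1 + N - a k.-1 = b' k.-1 - a k.-1 + N)%N; last by lia.
    by have := gN _ _ abk; lia.
  exists (exist _ z zadm); last first.
    by apply: coordinates_inj; apply/funext => n; rewrite iter_shiftE/= zp.
  move=> i n ik nI; apply: agree_resolution => // t tN.
  rewrite !iter_shiftE [RHS](zx i)//; last by lia.
  by congr (coordinates (x i) _); lia.
split=> [|p _]; last exact: periodic.
by have [z zs _] := periodic _ (leqnn _); exists z.
Qed.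

(** Shadow [y] on two segments of length [n], as close together as [M] permits and with the least
    permitted period [2 (n + m - 1)]. At precision [2^-1] the periodic point has letters on both
    segments, so [admissible_periodic_gap] yields [g n <= m - 1]. *)
Lemma specification_gap_ge (y : X) (M : nat -> R -> nat) n :
  (forall i, isSome (coordinates y i)) ->
  nonuniform_periodic_specification left_shift M -> (0 < n)%N ->
  (g n <= M n 2^-1)%N.
Proof.
move=> ysome [[M0 _ _] Mspec] n0; set m := M n 2^-1.
have h0 : 0 < 2^-1 :> R by rewrite invr_gt0.
have m0 : (0 < m)%N by exact: M0.
pose a i := (i * (n.-1 + m))%N.
pose b' i := (i * (n.-1 + m) + n.-1)%N.
have baE i : (b' i - a i).+1 = n by rewrite /b' /a; lia.
have [|||_ /(_ (n + m.-1).*2)] := Mspec _ h0 2 isT (fun=> y) a b'.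
- by move=> i _; rewrite /a /b'; lia.
- by move=> i _; rewrite /a /b' mulSn; lia.
- by move=> i _; rewrite baE -/m /a /b' mulSn; lia.
case=> [||z zs zp]; first by lia.
  by rewrite baE -/m /a /b' /=; lia.
have zy i t : (i < 2)%N -> (t < n)%N ->
    isSome (coordinates z (i * (n + m.-1) + t)).
  move=> i2 tn; have := zs i (a i + t)%N i2.
  rewrite addKn (_ : a i + t = i * (n + m.-1) + t)%N; last by rewrite /a; nia.
  have -> : (a i <= i * (n + m.-1) + t <= b' i)%N by rewrite /a /b'; nia.
  move=> /(_ isT) zt.
  have zyt : coordinates (iter t left_shift y) 0 =
      coordinates (iter (i * (n + m.-1) + t) left_shift z) 0.
    apply: contrapT => /mdist_gt_half; rewrite ltNge; exact/negP/negPn.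
  by move: zyt; rewrite !iter_shiftE !addn0 => <-.
have zper t : coordinates z ((n + m.-1).*2 + t) = coordinates z t.
  by rewrite -iter_shiftE zp.
have : (g n <= m.-1)%N.
  apply: (admissible_periodic_gap g_mono (coordinatesP z) n0 zper).
    by move=> t tn; exact: (zy 0%N t isT tn).
  by move=> t tn; have := zy 1%N t isT tn; rewrite mul1n.
by lia.
Qed.

End GapShift.

Arguments gap_bound {R} g n e.

(** * Entropy *)

Section ExtendedReals.
Context {R : realType}.
Implicit Types (u v : (\bar R)^nat) (x y l : \bar R).
Local Open Scope ereal_scope.

Lemma limn_esup_le u l : (\forall n \near \oo, u n <= l) -> limn_esup u <= l.
Proof.
move=> ul; rewrite /limn_esup limf_esupE.
apply: (@le_trans _ _ (ereal_sup [set u n | n in [set n | u n <= l]])).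
  by apply: ereal_inf_lbound; exists [set n | u n <= l].
by apply: ge_ereal_sup => _ [n nl <-].
Qed.

Lemma limn_einf_ge u l : (\forall n \near \oo, l <= u n) -> l <= limn_einf u.
Proof.
move=> lu; rewrite /limn_einf leeNr; apply: limn_esup_le.
by apply: filterS lu => n; rewrite leeN2.
Qed.

Lemma le_limn_esup u v : (forall n, u n <= v n) -> limn_esup u <= limn_esup v.
Proof.
move=> uv; rewrite {2}/limn_esup limf_esupE; apply: le_ereal_inf_tmp => _ [A FA <-].
apply: limn_esup_le; apply: filterS FA => n An.
by rewrite (le_trans (uv n))//; apply: ereal_sup_ubound; exists n.
Qed.

Lemma le_lne x y : 0 <= x -> x <= y -> lne x <= lne y.
Proof.
move=> x0 xy; rewrite lee_lne// in_itv/= leey andbT//.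
exact: le_trans xy.
Qed.

Lemma lee_fin_lt x y : (forall r, r%:E < x -> r%:E <= y) -> x <= y.
Proof.
move=> xy; rewrite leNgt; apply/negP => yx.
have [r /andP[yr rx]] : exists r, y < r%:E < x.
  case: x y yx {xy} => [a| |] [c| |]//.
  - by rewrite lte_fin => ca; exists ((c + a) / 2)%R; rewrite !lte_fin !midf_lt.
  - by move=> _; exists (a - 1)%R; rewrite ltNyr lte_fin ltrBlDr ltrDl ltr01.
  - by move=> _; exists (c + 1)%R; rewrite ltry lte_fin ltrDl ltr01.
  - by move=> _; exists 0%R; rewrite ltNyr ltry.
by have := xy r rx; rewrite leNgt yr.
Qed.

End ExtendedReals.

Section Counting.
Context {R : realType} {T : choiceType} {W : finType}.
Implicit Type E : set T.

Lemma counting_le E (h : T -> W) (S : {set W}) :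
  {in E &, injective h} -> (forall x, E x -> h x \in S) ->
  (@counting T R E <= #|S|%:R%:E)%E.
Proof.
move=> hE hS.
have Efin : finite_set E.
  have := inj_card_eq hE; rewrite card_eq_le => /andP[_ /card_le_finite]; apply.
  exact: finite_finset.
rewrite /counting asboolT// lee_fin ler_nat cardE.
rewrite -(size_map h) uniq_leq_size//.
  rewrite map_inj_in_uniq ?fset_uniq// => x y.
  by rewrite !in_fset_set// => xE yE; exact: hE.
by move=> _ /mapP[x + ->]; rewrite in_fset_set// inE mem_enum => /hS.
Qed.

Lemma counting_range_ge E (h : W -> T) : injective h -> (forall w, E (h w)) ->
  (#|W|%:R%:E <= @counting T R E)%E.
Proof.
move=> hinj hE; rewrite /counting; case: ifPn => [/asboolP Efin|_]; last exact: leey.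
rewrite lee_fin ler_nat cardE -(size_map h) uniq_leq_size//.
  by rewrite map_inj_uniq// enum_uniq.
by move=> _ /mapP[w _ ->]; rewrite in_fset_set// inE.
Qed.

End Counting.

Section Entropy.
Context {R : realType} {g : nat -> nat} {b : nat}.
Local Notation X := (gap_shift R g b).
Implicit Types (x y : X).

Definition aperiodic (s : nat -> bool) := forall i p, (0 < p)%N ->
  exists2 j, (j < 4 * p)%N & s (i + j)%N <> s (i + j + p)%N.

(** There are no blanks, so the gap condition is vacuous, and [s] alone witnesses aperiodicity
    whatever [c] is. *)
Lemma coded_admissible s (c : nat -> 'I_b.+1) : aperiodic s ->
  admissible g (fun i => Some (s i, c i) : letter b).
Proof.
move=> sap; split=> // i p p0 _; have [j j4 sj] := sap i p p0.
by exists j => //; case.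
Qed.

Definition coded s c (sap : aperiodic s) : X := exist _ _ (coded_admissible c sap).

Let f : X -> X := left_shift.

Lemma max_separated_ge1 n e : (1 <= max_separated f n e)%E.
Proof.
rewrite (le_trans (y := @counting X R [set all_none]))//.
  rewrite /counting asboolT; last exact: finite_set1.
  by rewrite fset_set1 finmap.cardfs1.
by apply: ereal_sup_ubound; exists [set all_none] => // x y -> ->.
Qed.

Let entropy_at (e : R) : \bar R :=
  limn_esup (fun n => ((n%:R)^-1)%:E * lne (max_separated f n e))%E.

(** Separation at scale [e] grows as [e] decreases, so the limit at [0] is a supremum. *)
Lemma htopE : htop f = ereal_sup (entropy_at @` `]0, 1[ ).
Proof.
rewrite /htop; apply/cvg_lim => //.
apply: nonincreasing_at_right_cvge; first by rewrite bnd_simp.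
move=> e e' _ _ ee'; apply: le_limn_esup => n.
rewrite lee_wpmul2l ?lee_fin ?invr_ge0//; apply: le_lne.
  by rewrite (le_trans _ (max_separated_ge1 _ _)).
apply: le_ereal_sup => _ [E sepE <-]; exists E => // x y Ex Ey xy.
by have [i ni ei] := sepE x y Ex Ey xy; exists i => //; exact: le_lt_trans ei.
Qed.

(** With the code [s] fixed, the free components at the first [n] positions give [(b + 1)^n] points
    that are pairwise separated at scale [2^-1]. *)
Lemma htop_ge s : aperiodic s -> ((ln b.+1%:R)%:E <= htop f)%E.
Proof.
move=> sap; rewrite htopE.
apply: (@le_trans _ _ (entropy_at 2^-1)); last first.
  apply: ereal_sup_ubound; exists 2^-1 => //=.
  by rewrite in_itv/= invr_gt0 ltr0n invf_lt1// ltr1n.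
rewrite (le_trans _ (limn_einf_sup _))//; apply: limn_einf_ge; near=> n.
have n0 : (0 < n)%N by near: n; exists 1%N.
have nR : 0 < n%:R :> R by rewrite ltr0n.
pose pad (w : {ffun 'I_n -> 'I_b.+1}) i := if insub i is Some k then w k else ord0.
pose h w : X := coded (pad w) sap.
have hpad w (k : 'I_n) : coordinates (h w) k = Some (s k, w k).
  by rewrite /= /pad; case: insubP => [u _ /val_inj ->//|]; rewrite ltn_ord.
have hinj : injective h.
  move=> w w' ww; apply/ffunP => k.
  by have := hpad w k; rewrite ww hpad => -[->].
have cardW : ((b.+1 ^ n)%:R%:E <= max_separated f n 2^-1)%E.
  apply: (@le_trans _ _ (@counting X R (range h))).
    have := @counting_range_ge R X _ (range h) h hinj (fun w => imageT h w).
    by rewrite card_ffun !card_ord.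
  apply: ereal_sup_ubound; exists (range h) => // _ _ [w _ <-] [w' _ <-] ww.
  have [k wk] : exists k, w k <> w' k.
    by apply/existsNP => wk; apply: ww; congr h; exact/ffunP.
  exists k => //; apply: mdist_gt_half.
  by rewrite !iter_shiftE addn0 !hpad => -[].
rewrite (le_trans (y := (n%:R^-1)%:E * lne ((b.+1 ^ n)%:R%:E)))%E//.
  rewrite lne_EFin ?ltr0n ?expn_gt0// -EFinM lee_fin natrX lnXn ?ltr0n//.
  by rewrite -[X in _ * X]mulr_natl mulrA mulVf ?mul1r// gt_eqF.
by rewrite lee_wpmul2l ?lee_fin ?invr_ge0//; apply: le_lne.
Unshelve. all: by end_near. Qed.

Lemma htop_lty : (htop f < +oo)%E.
Proof.
(* Separated points differ within their first [n + N] symbols; the factor 2 comes from [N <= n] for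
   large [n]. *)
pose C := 2 * ln #|letter b|%:R : R.
apply: (@le_lt_trans _ _ C%:E); last exact: ltry.
rewrite htopE; apply: ge_ereal_sup => _ [e + <-] => /=; rewrite in_itv/= => /andP[e0 _].
set N := resolution e.
have A0 : (0 < #|letter b|)%N by apply/card_gt0P; exists None.
apply: limn_esup_le; near=> n.
have n0 : (0 < n)%N by near: n; exists 1%N.
have nN : (N <= n)%N by near: n; exists N.
have nR : 0 < n%:R :> R by rewrite ltr0n.
have max_le : (max_separated f n e <= (#|letter b| ^ (n + N))%:R%:E)%E.
  apply: ge_ereal_sup => _ [E sepE <-].
  pose h x := [ffun i : 'I_(n + N) => coordinates x i].
  have := @counting_le R X _ E h [set: {ffun 'I_(n + N) -> letter b}].
  rewrite cardsT card_ffun card_ord => ->//.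
  move=> x y; rewrite !inE => Ex Ey /ffunP hxy.
  apply: contrapT => xy; have [i ni] := sepE x y Ex Ey xy.
  rewrite ltNge => /negP; apply; apply: agree_resolution => // t tN.
  rewrite !iter_shiftE; have itN : (i + t < n + N)%N by rewrite -/N in tN; lia.
  by have := hxy (Ordinal itN); rewrite !ffunE.
rewrite (le_trans (y := (n%:R^-1)%:E * lne ((#|letter b| ^ (n + N))%:R%:E)))%E//.
  rewrite lee_wpmul2l ?lee_fin ?invr_ge0//; apply: le_lne => //.
  by rewrite (le_trans _ (max_separated_ge1 _ _)).
rewrite lne_EFin ?ltr0n ?expn_gt0 ?A0// -EFinM lee_fin natrX lnXn ?ltr0n//.
rewrite -[X in _ * X]mulr_natl mulrA ler_wpM2r ?ln_ge0 ?ler1n//.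
by rewrite ler_pdivrMl// -natrM ler_nat; lia.
Unshelve. all: by end_near. Qed.

End Entropy.

(** * Growth of periodic points and optimal gaps *)

Section Growth.
Context {R : realType} {g : nat -> nat} {b : nat}.
Local Notation X := (gap_shift R g b).
Let f : X -> X := left_shift.
Variable kappa : R.
Hypothesis kappa0 : 0 <= kappa.
Hypothesis kappa_g : forall n, kappa * n%:R <= (g n)%:R.
Hypothesis g_mono : {homo g : m n / (m <= n)%N}.
Let theta := (1 + kappa)^-1.

(* Weighting a word by (b + 1) to the power theta n - #nonzero letters bounds
   from below by 1 every word read along a period. *)
Lemma counting_Per n : (0 < n)%N ->
  (counting (Per f n) <= (expR (n%:R * (theta * ln b.+1%:R + ln 3)))%:E)%E.
Proof.
move=> n0; set L : R := ln b.+1%:R.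
pose nz (w : {ffun 'I_n -> letter b}) := (\sum_(i < n) isSome (w i))%N.
pose S := [set w : {ffun 'I_n -> letter b} | theta * n%:R >= (nz w)%:R]%SET.
pose h (x : X) := [ffun i : 'I_n => coordinates x i].
have perE x : Per f n x -> forall i, coordinates x (n + i) = coordinates x i.
  by move=> xn i; rewrite -iter_shiftE xn.
rewrite (le_trans (counting_le (h := h) (S := S) _ _))//.
- move=> x y; rewrite !inE => /perE xn /perE yn /ffunP xy.
  apply: coordinates_inj; apply/funext => i.
  have xm (z : X) k t : (forall i, coordinates z (n + i) = coordinates z i) ->
      coordinates z (k * n + t) = coordinates z t.
    by move=> zn; elim: k => // k IH; rewrite mulSn -addnA zn.
  rewrite (divn_eq i n) !xm//.
  by have := xy (Ordinal (ltn_pmod i n0)); rewrite !ffunE.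
- move=> x /perE xn; rewrite inE /theta.
  have := admissible_periodic_frequency g_mono kappa_g kappa0 (coordinatesP x) xn.
  have -> : nz (h x) = (\sum_(i < n) isSome (coordinates x i))%N.
    by apply: eq_bigr => i _; rewrite ffunE.
  set c := (\sum_(i < n) isSome _)%N; set d := (\sum_(i < n) ~~ _)%N => cd.
  have -> : n%:R = c%:R + d%:R :> R.
    rewrite -natrD -big_split/= (eq_bigr (fun=> 1%N)) ?sum1_card ?card_ord// => i _.
    by case: isSome.
  rewrite ler_pdivlMl; last by rewrite ltr_wpDr.
  by move: cd; rewrite mulrDl mul1r; lra.
rewrite lee_fin -sum1_card natr_sum.
pose wt (w : {ffun 'I_n -> letter b}) : R :=
  \prod_(i < n) (if isSome (w i) then b.+1%:R^-1 else 1).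
have wtE w : wt w = expR (- L * (nz w)%:R).
  rewrite /wt /nz natr_sum mulr_sumr expR_sum; apply: eq_bigr => i _.
  case: isSome; last by rewrite mulr0 expR0.
  by rewrite mulr1 expRN lnK// posrE ltr0n.
have wt0 w : 0 <= wt w by rewrite wtE expR_ge0.
apply: (@le_trans _ _ (\sum_(w in S) expR (L * (theta * n%:R)) * wt w)).
  apply: ler_sum => w; rewrite inE => wS.
  rewrite wtE -expRD -[X in X <= _]expR0 ler_expR.
  by rewrite mulNr -mulrBr mulr_ge0 ?subr_ge0// ln_ge0// ler1n.
have -> : n%:R * (theta * L + ln 3) = L * (theta * n%:R) + n%:R * ln 3 by lra.
rewrite -mulr_sumr expRD ler_wpM2l ?expR_ge0//.
rewrite expRM_natl lnK ?posrE ?ltr0n//.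
rewrite -(@sum_word_weight b R n) [leRHS](bigID (mem S))/= lerDl sumr_ge0// => w _.
exact: wt0.
Qed.

Lemma periodic_growth_rate_le :
  (periodic_growth_rate f <= (theta * ln b.+1%:R + ln 3)%:E)%E.
Proof.
apply: limn_esup_le; near=> n.
have n0 : (0 < n)%N by near: n; exists 1%N.
set C := theta * _ + _.
rewrite (le_trans (y := (n%:R^-1)%:E * lne (expR (n%:R * C))%:E)%E)//.
  rewrite lee_wpmul2l ?lee_fin ?invr_ge0//; apply: le_lne; last exact: counting_Per.
  by rewrite /counting; case: ifP => _; rewrite ?leey// lee_fin ler0n.
by rewrite lne_EFin ?expR_gt0// expRK -EFinM mulKf// pnatr_eq0 -lt0n.
Unshelve. all: by end_near. Qed.

(** The two hypotheses express that [g n / n] tends to [tau], the upper one being stable under the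
    bounded shifts in [gap_bound]. Any gap function dominates [g] at precision [2^-1], and
    [gap_bound] has rate at most [tau] at every precision. *)
Lemma gap_shift_tau (tau : \bar R) (y : X) :
  (forall i, isSome (coordinates y i)) ->
  (forall r, (r%:E < tau)%E -> \forall n \near \oo, r * n%:R <= (g n)%:R) ->
  (forall r, (tau < r%:E)%E -> forall N c : nat,
    \forall n \near \oo, (g (n + N) + c)%:R <= r * n%:R) ->
  nonuniform_periodic_tau_specification f tau.
Proof.
move=> ysome low upp.
have rate_ge M : nonuniform_periodic_specification f M -> (tau <= gap_rate M)%E.
  move=> Mspec; apply: (@le_trans _ _ (limn_einf (fun n => ((M n 2^-1)%:R / n%:R)%:E))).
    apply: lee_fin_lt => r /low rg; apply: limn_einf_ge.
    near=> n.
    have n0 : (0 < n)%N by near: n; exists 1%N.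
    rewrite lee_fin ler_pdivlMr ?ltr0n// (le_trans (y := (g n)%:R))//.
      by near: n.
    by rewrite ler_nat; exact: (specification_gap_ge g_mono ysome Mspec n0).
  by apply: ereal_sup_ubound; exists 2^-1 => //=; rewrite invr_gt0.
split=> //; exists (gap_bound g); first exact: gap_shift_specification.
apply/eqP; rewrite eq_le rate_ge ?andbT; last exact: gap_shift_specification.
apply: ge_ereal_sup => _ [e /= e0 <-].
rewrite -leeN2; apply: lee_fin_lt => r; rewrite lteNr -EFinN => /upp rg.
rewrite leeNr -EFinN (le_trans (limn_einf_sup _))//; apply: limn_esup_le.
near=> n.
have n0 : (0 < n)%N by near: n; exists 1%N.
rewrite lee_fin ler_pdivrMr ?ltr0n// /gap_bound -addnS.
by near: n; exact: rg.
Unshelve. all: by end_near. Qed.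

End Growth.

(** * The 2-adic odometer *)

Section Odometer.
Local Open Scope nat_scope.
Implicit Types (w : nat -> bool) (m n : nat).

(* A 0-1 sequence is a 2-adic integer, least significant digit first. *)
Definition residue m w := \sum_(i < m) w i * 2 ^ i.

(** Addition of 1: the carry reaches digit [n] exactly when all lower digits are 1. *)
Definition odometer w : nat -> bool := fun n => w n (+) [forall i : 'I_n, w i].

Lemma residueS m w : residue m.+1 w = residue m w + w m * 2 ^ m.
Proof. by rewrite /residue big_ord_recr. Qed.

Lemma ltn_residue m w : residue m w < 2 ^ m.
Proof.
elim: m => [|m IH]; first by rewrite /residue big_ord0.
by rewrite residueS expnS; case: (w m); lia.
Qed.

Lemma residue_odometer_carry m w :
  residue m (odometer w) + [forall i : 'I_m, w i] * 2 ^ m = (residue m w).+1.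
Proof.
elim: m => [|m IH].
  rewrite /residue !big_ord0 (_ : [forall _, _] = true)//.
  by apply/forallP => -[].
have -> : [forall i : 'I_m.+1, w i] = [forall i : 'I_m, w i] && w m.
  apply/forallP/andP => [wm|[/forallP wm wm1] i].
    split; last exact: (wm ord_max).
    by apply/forallP => i; exact: (wm (widen_ord (leqnSn m) i)).
  by case: (unliftP ord_max i) => [j ->|->//]; rewrite lift_max.
rewrite !residueS expnS (_ : odometer w m = w m (+) [forall i : 'I_m, w i])//.
by move: IH; case: [forall _, _]; case: (w m) => /=; lia.
Qed.

Lemma residue_odometer m w :
  residue m (odometer w) = (residue m w).+1 %% 2 ^ m.
Proof.
rewrite -residue_odometer_carry; have := ltn_residue m (odometer w).
by move=> rm; case: [forall _, _]; rewrite ?mul1n ?modnDr ?mul0n ?addn0 modn_small.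
Qed.

Lemma residue_iter m n w :
  residue m (iter n odometer w) = (residue m w + n) %% 2 ^ m.
Proof.
elim: n => [|n IH]; first by rewrite addn0 modn_small// ltn_residue.
by rewrite iterS residue_odometer IH -addn1 modnDml addn1 addnS.
Qed.

Lemma residue_mod m w : residue m.+1 w = residue m w %[mod 2 ^ m].
Proof. by rewrite residueS addnC modnMDl. Qed.

(** This is the parity of the 2-adic valuation of [w + 1], set to [false] at [w = -1], the sequence
    of ones. Along an odometer orbit it produces a period-doubling sequence. *)
Definition first_zero_parity w : bool :=
  if pselect (exists n, ~~ w n) is left ex then odd (ex_minn ex) else false.

(** The hypothesis says that the digits start with [r] ones followed by a zero. *)
Lemma first_zero_parityP r w : residue r.+1 w = 2 ^ r - 1 ->
  first_zero_parity w = odd r.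
Proof.
move=> wr.
have w0 : w r = false.
  by apply/negP => wr1; move: wr; rewrite residueS wr1; have := expn_gt0 2 r; lia.
have : [forall i : 'I_r, w i].
  have := residue_odometer_carry r w; have := ltn_residue r (odometer w).
  move: wr; rewrite residueS w0 mul0n addn0 => ->.
  by case: [forall _, _] => //; have := expn_gt0 2 r; lia.
move=> /forallP wall; rewrite /first_zero_parity; case: pselect => [ex|]; last first.
  by case; exists r; rewrite w0.
case: ex_minnP => n wn nmin; congr (odd _); apply/eqP; rewrite eqn_leq.
rewrite nmin ?w0//= leqNgt; apply: contra wn => nr.
exact: (wall (Ordinal nr)).
Qed.

Definition ruler w n := first_zero_parity (iter n odometer w).

(* If p = 2^a q with q odd, a suitable j makes the first zero of the 2-adic
   integer at time i + j occur at a, and the one at time i + j + p at a + 1. *)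
Lemma ruler_aperiodic w : aperiodic (ruler w).
Proof.
move=> i p p0; have [q qodd pE] := pfactor_coprime (isT : prime 2) p0.
set a := logn 2 p in pE.
have {qodd}[q' qE] : exists q', q = q'.*2.+1.
  by exists q./2; rewrite -[LHS]odd_double_half; move: qodd; rewrite coprime2n => ->.
set r := residue a.+2 w + i.
(* Here [c] is [2^(a+1) - 1 - p] modulo [2^(a+2)], and [j] below is [c - r], both written without
   negative numbers. As [p] is an odd multiple of [2^a], [c] is [2^a - 1] modulo [2^(a+1)]. *)
pose c := 2 ^ a.+1 - 1 + p * (2 ^ a.+2 - 1).
have e0 := expn_gt0 2 a.
have eS : 2 ^ a.+1 = 2 * 2 ^ a by rewrite expnS.
have eSS : 2 ^ a.+2 = 4 * 2 ^ a by rewrite !expnS; lia.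
pose j := (c + r * (2 ^ a.+2 - 1)) %% 2 ^ a.+2.
have rjE : r + j = c %[mod 2 ^ a.+2].
  rewrite /j modnDmr (_ : r + (c + r * (2 ^ a.+2 - 1)) = r * 2 ^ a.+2 + c).
    by rewrite modnMDl.
  rewrite addnCA addnC; congr (_ + _); rewrite mulnBr muln1 subnKC//.
  by rewrite -[X in X <= _]muln1 leq_mul2l; lia.
exists j.
  (* The window [4 * p] comes from here: [j < 2^(a+2) <= 4 p]. *)
  have jlt : j < 2 ^ a.+2 by rewrite ltn_mod; lia.
  by rewrite (leq_trans jlt)// eSS pE qE leq_mul2l/= leq_pmull.
suff : first_zero_parity (iter (i + j) odometer w) = odd a /\
       first_zero_parity (iter (i + j + p) odometer w) = odd a.+1.
  by rewrite /ruler => -[-> ->] /=; case: (odd a).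
split; apply: first_zero_parityP; rewrite residue_iter.
  have -> : residue a.+1 w + (i + j) = c %[mod 2 ^ a.+1].
    rewrite -[LHS]modnDml -residue_mod modnDml addnA -/r.
    have d : 2 ^ a.+1 %| 2 ^ a.+2 by rewrite dvdn_exp2l.
    by rewrite -(modn_dvdm _ d) rjE modn_dvdm.
  rewrite (_ : c = (q' * (2 * 2 ^ a.+1 - 1) + 2 ^ a.+1) * 2 ^ a.+1 + (2 ^ a - 1)).
    by rewrite modnMDl modn_small//; lia.
  rewrite /c pE qE eSS eS; move: (2 ^ a) e0 => e e0.
  case: e e0 => // e _; rewrite -muln2 -[e.+1]addn1 -[(q' * 2).+1]addn1.
  rewrite (_ : 2 * (e + 1) - 1 = 2 * e + 1); last by lia.
  rewrite (_ : 4 * (e + 1) - 1 = 4 * e + 3); last by lia.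
  rewrite (_ : 2 * (2 * (e + 1)) - 1 = 4 * e + 3); last by lia.
  by rewrite addnK; ring.
rewrite addnA addnA -/r -[X in X %% _]/(r + j + p) -modnDml rjE modnDml.
rewrite (_ : c + p = p * 2 ^ a.+2 + (2 ^ a.+1 - 1)).
  by rewrite modnMDl modn_small//; lia.
by rewrite /c -addnA mulnBr muln1 subnK ?leq_pmulr ?expn_gt0// addnC.
Qed.

End Odometer.

(** * The sigma-algebra generated by residue classes modulo powers of 2 *)

Lemma finite_measure_eq d (T : measurableType d) (R : realType)
    (G : set (set T)) (m1 m2 : {measure set T -> \bar R}) :
  @measurable d T = <<s G >> -> setI_closed G -> G [set: T] ->
  (forall A, G A -> m1 A = m2 A) -> (m1 [set: T] < +oo)%E ->
  forall A, measurable A -> m1 A = m2 A.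
Proof.
move=> TG GI GT m12 m1oo A; rewrite {1}TG => GA.
apply: (@g_sigma_algebra_measure_unique _ _ _ G _ (fun=> setT)) => //.
- by rewrite TG; exact: sub_gen_smallest.
- by rewrite bigcup_const.
Qed.

(** Values [j >= 2 ^ m] are allowed and give the empty set, as closure under intersection
    requires. *)
Definition residue_sets : set (set (nat -> bool)) :=
  [set A | exists m j, A = [set w | residue m w = j]].

Notation binary_seq := (g_sigma_algebraType residue_sets).

Section BinarySequences.

Lemma measurable_residue m (P : set nat) :
  measurable ([set w | P (residue m w)] : set binary_seq).
Proof.
rewrite (_ : [set w | _] = \bigcup_(j in P) [set w | residue m w = j]).
  apply: bigcup_measurable => j _; apply: sub_sigma_algebra.
  by exists m, j.
apply/seteqP; split=> [w /= Pw|w [j Pj /= ->//]].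
by exists (residue m w).
Qed.

(** Two residue classes modulo powers of 2 are nested or disjoint. *)
Lemma setI_closed_residue_sets : setI_closed residue_sets.
Proof.
have key m n w : residue (m + n) w = residue m w %[mod 2 ^ m].
  elim: n => [|n IH]; first by rewrite addn0.
  by rewrite addnS residueS expnD mulnA mulnAC addnC modnMDl.
have wlog_key m j n k :
    residue_sets ([set w | residue m w = j] `&` [set w | residue (m + n) w = k]).
  have [kj|kj] := eqVneq (k %% 2 ^ m)%N j.
    exists (m + n)%N, k; rewrite setIidr// => w /= wk.
    by rewrite -(modn_small (ltn_residue m w)) -(key m n) wk.
  exists 0%N, 1%N; apply/seteqP; split=> w /=; last by rewrite /residue big_ord0.
  case=> wj wk; exfalso; move/eqP: kj; apply.
  by rewrite -wk key wj modn_small// -wj ltn_residue.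
move=> _ _ [m [j ->]] [n [k ->]]; have [mn|nm] := leqP m n.
  by rewrite -(subnKC mn); exact: wlog_key.
by rewrite setIC -(subnKC (ltnW nm)); exact: wlog_key.
Qed.

Lemma residue_setT : residue_sets setT.
Proof.
exists 0%N, 0%N; apply/seteqP; split=> w //= _.
by rewrite /residue big_ord0.
Qed.

Lemma measurable_odometer :
  measurable_fun setT (odometer : binary_seq -> binary_seq).
Proof.
apply: (@measurability _ _ binary_seq binary_seq setT odometer residue_sets erefl)
  => _ [_ [m [j ->]] <-].
rewrite setTI /preimage/=.
under eq_set do rewrite residue_odometer.
exact: (measurable_residue m [set r | r.+1 %% 2 ^ m = j]%N).
Qed.

End BinarySequences.

(** * Binary digits of real numbers *)

Section Digits.
Context {R : realType}.
Implicit Types u : R.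

Definition doubling u : R := if u < 2^-1 then 2 * u else 2 * u - 1.

(** On [[0, 1)] the leading binary digit of [u] becomes the least significant 2-adic digit, so that
    dyadic intervals correspond to residue classes. *)
Definition digits u : nat -> bool := fun n => 2^-1 <= iter n doubling u.

Lemma residue_digits m u :
  residue m.+1 (digits u) = ((2^-1 <= u)%R + 2 * residue m (digits (doubling u)))%N.
Proof.
rewrite /residue big_ord_recl expn0 muln1; congr (_ + _)%N.
rewrite big_distrr/=; apply: eq_bigr => i _.
by rewrite /digits /bump leq0n add1n iterSr expnS mulnCA.
Qed.

Lemma measurable_digits : measurable_fun setT (digits : R -> binary_seq).
Proof.
apply: (@measurability _ _ _ binary_seq setT digits residue_sets erefl)
  => _ [_ [m [j ->]] <-].
rewrite setTI /preimage/=.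
(* Arbitrary sets of residues are needed for the induction, which replaces [P] by its preimages
   under [r -> 2 r] and [r -> 1 + 2 r]. *)
suff mP (P : set nat) : measurable [set u | P (residue m (digits u))].
  exact: (mP [set r | r = j]).
elim: m P => [|m IH] P.
  rewrite (_ : [set u | _] = [set u | P 0%N]).
    by have [P0|P0] := pselect (P 0%N);
      [rewrite (_ : [set _ | _] = setT)|rewrite (_ : [set _ | _] = set0)] => //;
      apply/seteqP; split.
  by apply/seteqP; split=> u /=; rewrite /residue big_ord0.
have aff (c : R) : measurable_fun setT (fun u => 2 * u + c).
  by apply: measurable_funD => //; exact: measurable_funM.
rewrite (_ : [set u | _] =
    (`]-oo, 2^-1[ `&` (setT `&` (fun u => 2 * u + 0) @^-1`
        [set u | P (2 * residue m (digits u))%N])) `|`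
    (`[2^-1, +oo[ `&` (setT `&` (fun u => 2 * u + (- 1)) @^-1`
        [set u | P (1 + 2 * residue m (digits u))%N]))).
  apply: measurableU; apply: measurableI => //.
    exact: (aff 0 measurableT _ (IH [set r | P (2 * r)%N])).
  exact: (aff (-1) measurableT _ (IH [set r | P (1 + 2 * r)%N])).
apply/seteqP; split=> u; rewrite /= residue_digits /doubling !in_itv/= !andbT addr0.
  by case: ltP => u2; [left|right].
by case: ltP => u2 [] [//] _ [].
Qed.

(** The left end [q] is the bit reversal of [j] divided by [2 ^ m]: the interval of [j./2] is
    halved, and moved right by one half when [j] is odd. *)
Lemma residue_digits_itv m j : (j < 2 ^ m)%N -> exists q : R,
  [/\ 0 <= q, q + 2 ^- m <= 1 & forall u, 0 <= u < 1 ->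
     residue m (digits u) = j <-> q <= u < q + 2 ^- m].
Proof.
elim: m j => [|m IH] j.
  rewrite expn0 ltnS leqn0 => /eqP ->; exists 0; split=> //.
    by rewrite add0r invr1.
  by move=> u u01; rewrite /residue big_ord0 add0r expr0 invr1.
move=> jm; have [|q [q0 q1 qP]] := IH j./2.
  by rewrite ltn_half_double -mul2n -expnS.
have e0 : 0 < 2 ^- m :> R by rewrite invr_gt0 exprn_gt0.
have eE : 2 ^- m.+1 = 2 ^- m / 2 :> R by rewrite exprS invfM mulrC.
exists ((q + (odd j)%:R) / 2); rewrite eE; split.
- by rewrite mulr_ge0 ?addr_ge0.
- by case: (odd j) => /=; lra.
move=> u u01; rewrite residue_digits.
have jE := odd_double_half j; rewrite -mul2n in jE.
rewrite /doubling; case: ltP => u2 /=.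
  have [|uj ju] := qP (2 * u); first by lra.
  split=> [H|H].
    have oj : odd j = false by rewrite -H add0n oddM.
    have /uj : residue m (digits (2 * u)) = j./2 by lia.
    by rewrite oj /=; lra.
  have oj : odd j = false by move: H; case: (odd j) => //=; lra.
  by rewrite ju; [lia|move: H; rewrite oj /=; lra].
have [|uj ju] := qP (2 * u - 1); first by lra.
split=> [H|H].
  have oj : odd j by rewrite -H oddD oddM.
  have /uj : residue m (digits (2 * u - 1)) = j./2 by lia.
  by rewrite oj /=; lra.
have oj : odd j by move: H; case: (odd j) => //=; lra.
by rewrite ju; [lia|move: H; rewrite oj /=; lra].
Qed.

End Digits.

Section Probabilities.
Context {R : realType} {d} {T : measurableType d}.

Section OfMeasure.
Variables (mu : {measure set T -> \bar R}) (mu1 : mu [set: T] = 1%E).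
Definition probability_of of mu [set: T] = 1%E : set T -> \bar R := mu.
HB.instance Definition _ := Measure.copy (probability_of mu1) mu.
HB.instance Definition _ :=
  Measure_isProbability.Build _ _ _ (probability_of mu1) mu1.
End OfMeasure.

Lemma probability_pushforward d' (T' : measurableType d') (f : T -> T')
    (P : probability T R) : measurable_fun setT f ->
  exists Q : probability T' R, forall A, Q A = P (f @^-1` A).
Proof.
move=> mf.
pose F : {mfun T >-> T'} := HB.pack f (isMeasurableFun.Build d d' T T' f mf).
by exists (distribution P F).
Qed.

End Probabilities.

(** * Haar measure on the 2-adic integers and its ergodicity *)

Section OdometerMeasure.
Context {R : realType}.
Implicit Types P : probability binary_seq R.

Definition equidistributed P := forall m j, (j < 2 ^ m)%N ->
  P [set w | residue m w = j] = (2 ^- m)%:E.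

(** The image of Lebesgue measure on [[0, 1)] under [digits] works, since residue classes pull back
    to dyadic intervals. *)
Lemma exists_equidistributed : exists P, equidistributed P.
Proof.
have mI := measurable_itv `[0, 1[%R : measurable (`[0, 1[%classic : set R).
pose leb := mrestr (@lebesgue_measure R) mI.
have leb1 : leb setT = 1%E.
  by rewrite /leb /mrestr setTI lebesgue_measure_itv/= lte_fin ltr01 oppr0 addr0.
have [P PE] := probability_pushforward (probability_of leb1) measurable_digits.
exists P => m j jm; rewrite PE /probability_of /= /leb /mrestr.
have [q [q0 q1 qP]] := @residue_digits_itv R m j jm.
have e0 : 0 < 2 ^- m :> R by rewrite invr_gt0 exprn_gt0.
rewrite (_ : _ `&` _ = [set` `[q, q + 2 ^- m[]).
  by rewrite lebesgue_measure_itv/= lte_fin ltrDl e0 -EFinD addrAC subrr add0r.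
apply/seteqP; split=> u /=; rewrite !in_itv/=.
  by move=> [ru u01]; have [+ _] := qP u u01; exact.
move=> uq; have u01 : 0 <= u < 1 by lra.
by split=> //; have [_ +] := qP u u01; exact.
Qed.

(** The residue on the right is [j - 1] modulo [2 ^ m], kept nonnegative. *)
Lemma odometer_preimage m j : (j < 2 ^ m)%N ->
  odometer @^-1` [set w | residue m w = j] =
  [set w | residue m w = (j + 2 ^ m).-1 %% 2 ^ m]%N.
Proof.
move=> jm; have e0 : (0 < 2 ^ m)%N by rewrite expn_gt0.
apply/seteqP; split=> w /=; rewrite residue_odometer; have := ltn_residue m w.
  move=> wm <-; have [wm1|] := ltnP (residue m w).+1 (2 ^ m)%N.
    by rewrite (modn_small wm1) addSn/= modnDr modn_small.
  move=> mw; have -> : (residue m w).+1 = (2 ^ m)%N by lia.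
  by rewrite modnn add0n modn_small; lia.
move=> _ ->; case: j jm => [|j] jm.
  rewrite add0n (@modn_small _.-1); last by lia.
  by rewrite prednK ?modnn.
by rewrite addSn/= modnDr (modn_small (ltnW jm)) modn_small.
Qed.

Lemma residue_set_empty m j : ~~ (j < 2 ^ m)%N -> [set w | residue m w = j] = set0.
Proof.
by move=> jm; apply/seteqP; split=> // w /= wj; move: jm; rewrite -wj ltn_residue.
Qed.

Variables (P : probability binary_seq R) (P_eq : equidistributed P).

Lemma odometer_invariant (A : set binary_seq) : measurable A ->
  P (odometer @^-1` A) = P A.
Proof.
have [Q QE] := probability_pushforward P measurable_odometer.
move=> mA; rewrite -QE; apply: finite_measure_eq mA => //.
- exact: setI_closed_residue_sets.
- exact: residue_setT.
- move=> _ [m [j ->]]; rewrite -[LHS]/(Q _) QE.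
  have [jm|/residue_set_empty ->] := boolP (j < 2 ^ m)%N.
    rewrite odometer_preimage// P_eq ?ltn_mod ?expn_gt0//; exact/esym/P_eq.
  by rewrite preimage_set0 [RHS]measure0 measure0.
- by rewrite -[X in (X < _)%E]/(Q _) probability_setT ltry.
Qed.

(** The odometer permutes the classes modulo [2 ^ m] cyclically, so an invariant [A] meets all of
    them in equal mass and is independent of each. By uniqueness of measures it is independent of
    every measurable set, in particular of itself, whence [P A] equals its square. *)
Lemma odometer_ergodic (A : set binary_seq) : measurable A ->
  odometer @^-1` A = A -> P A = 0%E \/ P A = 1%E.
Proof.
move=> mA TA.
have mres m j : measurable ([set w | residue m w = j] : set binary_seq).
  exact: (measurable_residue m [set k | k = j]).
have mresA m j : measurable ([set w | residue m w = j] `&` A : set binary_seq).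
  exact: measurableI.
have PA m j : (j < 2 ^ m)%N ->
    P ([set w | residue m w = j] `&` A) = P ([set w | residue m w = 0%N] `&` A).
  elim: j => // j IH jm; rewrite -IH ?(ltnW jm)//.
  rewrite -odometer_invariant// preimage_setI TA odometer_preimage//.
  by rewrite addSn/= modnDr (modn_small (ltnW jm)).
have PAE m j : (j < 2 ^ m)%N ->
    P ([set w | residue m w = j] `&` A) = ((2 ^- m)%:E * P A)%E.
  move=> jm; rewrite PA//.
  have -> : P A = ((2 ^+ m)%:E * P ([set w | residue m w = 0%N] `&` A))%E.
    have {1}-> : A = \bigcup_(j in `I_(2 ^ m)) ([set w | residue m w = j] `&` A).
      apply/seteqP; split=> [w Aw|w [k _ []]//].
      by exists (residue m w) => //; exact: ltn_residue.
    rewrite measure_fin_bigcup//; first last.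
      by move=> k l _ _ [w [[<- _] [<- _]]].
    rewrite -fsbig_ord (eq_bigr (fun=> P ([set w | residue m w = 0%N] `&` A))).
      rewrite -[P (_ `&` _)]fineK ?fin_num_measure// sumEFin sumr_const card_ord.
      by rewrite -EFinM -[X in X%:E = _]mulr_natl natrX.
    by move=> i _; exact: PA.
  by rewrite muleA -EFinM mulVf ?mul1e// expf_neq0.
have Pfin : P A \is a fin_num by exact: fin_num_measure.
have PA0 : 0 <= fine (P A) by rewrite fine_ge0.
have : mrestr P mA A = mscale (NngNum PA0) P A.
  apply: finite_measure_eq (mA) => //.
  - exact: setI_closed_residue_sets.
  - exact: residue_setT.
  - move=> B [m [j ->]]; rewrite /mrestr /mscale.
    transitivity (P A * P [set w | residue m w = j])%E; last first.
      by congr (_ * _)%E; exact/esym/fineK.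
    have [jm|/residue_set_empty ->] := boolP (j < 2 ^ m)%N.
      by transitivity ((2 ^- m)%:E * P A)%E; [exact: PAE|rewrite P_eq// muleC].
    transitivity (0 : \bar R)%E; last by rewrite measure0 mule0.
    by rewrite -[RHS](measure0 P); congr (P _); exact: set0I.
  - by rewrite -[X in (X < _)%E]/(P (setT `&` A)) setTI ltey_eq Pfin.
have := fineK Pfin; move: (fine (P A)) PA0 => a a0 aE H.
have {H} : P A = (a%:E * P A)%E by rewrite -{1}(setIid A); exact: H.
rewrite -aE -EFinM => -[] /eqP.
rewrite -subr_eq0 -{1}[a]mulr1 -mulrBr mulf_eq0.
move=> /orP[/eqP ->|/eqP a1]; [by left|right].
by congr EFin; lra.
Qed.

End OdometerMeasure.

(** * Weak* closures of sets of measures *)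

Section LocalSets.
Context {R : realType} {g : nat -> nat} {b : nat}.
Local Notation X := (gap_shift R g b).
Local Notation f := (left_shift : X -> X).
Local Notation XB := (borel X).
Implicit Types (x y : X) (A B : set X) (mu nu : probability (borel X) R).

Definition local_at n A := forall x y,
  agree n (coordinates x) (coordinates y) -> A x -> A y.

(** Finite unions of cylinders: they form a pi-system generating the Borel sets, and their
    indicators are continuous, so their masses are weak* continuous. *)
Definition local_sets : set (set X) := [set A | exists n, local_at n A].

Lemma agree_le m n (x y : nat -> letter b) : (m <= n)%N -> agree n x y -> agree m x y.
Proof. by move=> mn xy i im; apply: xy; exact: leq_trans mn. Qed.

Lemma agree_sym n (x y : nat -> letter b) : agree n x y -> agree n y x.
Proof. by move=> xy i /xy. Qed.

Lemma open_local A : local_sets A -> open A.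
Proof.
move=> [n nA]; rewrite openE => x Ax; apply/nbhs_agree; exists n => y xy.
exact: nA xy Ax.
Qed.

(** An open set is the countable union over [n] of the sets of points whose cylinder of length [n]
    it contains. *)
Lemma borel_local : @measurable _ XB = <<s local_sets >>.
Proof.
apply/seteqP; split; last first.
  apply: smallest_sub; first exact: (@sigma_algebra_measurable _ XB).
  by move=> A /open_local Ao; exact: sub_sigma_algebra.
apply: smallest_sub; first exact: smallest_sigma_algebra.
move=> O Oo; rewrite (_ : O = \bigcup_n
    [set x | forall y, agree n (coordinates x) (coordinates y) -> O y]).
  apply: (@bigcup_measurable _ (g_sigma_algebraType local_sets)) => n _.
  apply: sub_sigma_algebra; exists n => x y xy /= xO z yz; apply: xO => i ni.
  by rewrite xy// yz.
apply/seteqP; split=> x.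
  by move: Oo; rewrite openE => /[apply] /nbhs_agree[n nO]; exists n.
by case=> n _; exact.
Qed.

Lemma measurable_local A : local_sets A -> measurable (A : set XB).
Proof. by move=> A0; rewrite borel_local; exact: sub_sigma_algebra. Qed.

Lemma setI_closed_local_sets : setI_closed local_sets.
Proof.
move=> A B [m mA] [n nB]; exists (maxn m n) => x y xy [Ax Bx]; split.
  by apply: mA Ax; apply: agree_le xy; exact: leq_maxl.
by apply: nB Bx; apply: agree_le xy; exact: leq_maxr.
Qed.

Lemma local_setT : local_sets setT.
Proof. by exists 0%N. Qed.

Lemma local_preimage A : local_sets A -> local_sets (f @^-1` A).
Proof.
move=> [n nA]; exists n.+1 => x y xy; apply: nA => i ni.
by apply: xy; rewrite add1n.
Qed.

Lemma measurable_left_shift : measurable_fun setT (f : XB -> XB).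
Proof.
apply: (@measurability _ _ XB XB setT f local_sets borel_local) => _ [A Al <-].
by rewrite setTI; apply: measurable_local; exact: local_preimage.
Qed.

Lemma continuous_indic_local A : local_sets A -> continuous (\1_A : X -> R).
Proof.
move=> [n nA] x U /= /nbhs_singleton Ux; apply/nbhs_agree; exists n => y xy.
suff E : \1_A x = \1_A y :> R by rewrite /preimage/= -E.
rewrite /indic; suff -> : (x \in A) = (y \in A) by [].
by apply/idP/idP; rewrite !inE; [exact: nA|exact/nA/agree_sym].
Qed.

Lemma continuous_measure_local A : local_sets A ->
  continuous (fun mu : borel_probability X => fine ((mu : probability XB R) A)).
Proof.
move=> Al; pose h : continuousType X R := mkcts (continuous_indic_local Al).
have hE : (fun mu : borel_probability X => fine ((mu : probability XB R) A)) =
          (fun mu => integrals mu h).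
  apply/funext => mu; rewrite /integrals /Rintegral integral_indic ?setIT//.
  exact: measurable_local.
rewrite hE => mu.
pose I : borel_probability X -> prod_topology (fun _ : continuousType X R => R) :=
  @integrals R X.
have Ic : {for mu, continuous I} by exact: initial_continuous.
have pc : {for I mu, continuous (@proj (continuousType X R) (fun=> R) h :
    prod_topology (fun _ : continuousType X R => R) -> R)}.
  exact: proj_continuous.
exact: (continuous_comp Ic pc).
Qed.

Lemma closure_sub_preimage (F : borel_probability X -> R) (D : set R)
    (S : set (borel_probability X)) : continuous F -> closed D ->
  (forall mu, S mu -> D (F mu)) -> closure S `<=` [set mu | D (F mu)].
Proof.
move=> Fc Dc SD mu Smu.
have Dcl : closed [set nu | D (F nu)].
  by apply: (@preimage_closed (borel_probability X) R F D) => // nu _; exact: Fc.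
by apply/Dcl/(closure_subset _ Smu) => nu; exact: SD.
Qed.

Lemma closure_invariant_sub (S : set (borel_probability X)) :
  S `<=` invariant_measures f -> closure S `<=` invariant_measures f.
Proof.
move=> SI mu Smu A mA.
have [Q QE] := probability_pushforward (mu : probability XB R) measurable_left_shift.
have -> : (mu : probability XB R) (f @^-1` A) = Q A by rewrite QE.
apply: (@finite_measure_eq _ XB R local_sets) mA => //.
- exact: borel_local.
- exact: setI_closed_local_sets.
- exact: local_setT.
- move=> B Bl; rewrite -[LHS]/(Q _) QE.
  have BF := local_preimage Bl.
  have fin (C : set X) : local_sets C -> (mu : probability XB R) C \is a fin_num.
    by move=> Cl; apply: fin_num_measure; exact: measurable_local.
  rewrite -(fineK (fin _ BF)) -[RHS](fineK (fin _ Bl)); congr EFin.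
  apply/eqP; rewrite -subr_eq0; apply/eqP.
  pose F (nu : borel_probability X) := fine ((nu : probability XB R) (f @^-1` B))
                                       - fine ((nu : probability XB R) B).
  apply: (@closure_sub_preimage F [set 0] S _ _ _ mu Smu).
  + move=> nu; apply: (@cvgB R R _ _ (nbhs_filter nu));
      [exact: (continuous_measure_local BF)|exact: (continuous_measure_local Bl)].
  + exact: closed_eq.
  + move=> nu Snu /=; rewrite /F (SI nu Snu) ?subrr//; exact: measurable_local.
- by rewrite -[X in (X < _)%E]/(Q _) probability_setT ltry.
Qed.

End LocalSets.

(** * Frequency of blanks *)

Lemma measure_count_le d (T : measurableType d) (R : realType)
    (mu : {measure set T -> \bar R}) (c : R) m n
    (A : 'I_m -> set T) (B : 'I_n -> set T) : 0 <= c ->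
  (forall i, measurable (A i)) -> (forall i, measurable (B i)) ->
  (forall x, c * (\sum_(i < m) \1_(A i) x) <= \sum_(i < n) \1_(B i) x) ->
  (c%:E * \sum_(i < m) mu (A i) <= \sum_(i < n) mu (B i))%E.
Proof.
move=> c0 mA mB cAB.
have sumE k (C : 'I_k -> set T) : (forall i, measurable (C i)) ->
    (\sum_(i < k) mu (C i) = \int[mu]_x (\sum_(i < k) \1_(C i) x)%:E)%E.
  move=> mC; under eq_integral do rewrite -sumEFin.
  rewrite ge0_integral_sum//.
    by apply: eq_bigr => i _; rewrite integral_indic ?setIT.
  by move=> i; apply/measurable_EFinP; exact: measurable_indic.
have msum k (C : 'I_k -> set T) : (forall i, measurable (C i)) ->
    measurable_fun setT (fun x => (\sum_(i < k) \1_(C i) x)%:E : \bar R).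
  move=> mC; apply/measurable_EFinP; apply: measurable_sum => i.
  exact: measurable_indic.
have sum0 k (C : 'I_k -> set T) x : 0 <= \sum_(i < k) \1_(C i) x :> R.
  by apply: sumr_ge0 => i _; rewrite /indic.
rewrite !sumE// -ge0_integralZl_EFin//; try exact: msum.
apply: ge0_le_integral => //; try exact: msum.
- by move=> x _; rewrite -EFinM lee_fin mulr_ge0.
- by apply: measurable_funeM; exact: msum.
- by move=> x _; rewrite -EFinM lee_fin.
- by move=> x _; rewrite lee_fin.
Qed.

Section ZeroFrequency.
Context {R : realType} {g : nat -> nat} {b : nat}.
Local Notation X := (gap_shift R g b).
Local Notation f := (left_shift : X -> X).
Local Notation XB := (borel X).
Variable kappa : R.
Hypothesis kappa0 : 0 <= kappa.
Hypothesis kappa_g : forall n, kappa * n%:R <= (g n)%:R.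
Hypothesis g_mono : {homo g : m n / (m <= n)%N}.
Implicit Types mu : probability XB R.

Definition starts_none : set X := [set x | coordinates x 0 = None].

Definition never_none : set X := [set x | forall i, isSome (coordinates x i)].

Lemma local_starts_none : local_sets starts_none.
Proof. by exists 1%N => x y xy; rewrite /starts_none/= xy. Qed.

Let closing_set L i : set X := [set x | closing L (coordinates x) i].

Let local_closing L i : local_sets (closing_set L i).
Proof.
exists (i + L).+1 => x y xy; rewrite /closing_set /closing/=.
rewrite xy; last by lia.
case: isSome => //= /existsP[l xl]; apply/existsP; exists l.
by rewrite -xy//; have := ltn_ord l; lia.
Qed.

Let none_at i : set X := [set x | coordinates x i = None].

Let local_none_at i : local_sets (none_at i).
Proof. by exists i.+1 => x y xy; rewrite /none_at/= xy. Qed.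

Lemma measurable_never_none : measurable (never_none : set XB).
Proof.
rewrite (_ : never_none = \bigcap_i ~` none_at i); last first.
  apply/seteqP; split=> x xS i.
    by move=> _; have := xS i; rewrite /none_at/=; case: coordinates.
  by have := xS i I; rewrite /none_at/=; case: coordinates.
apply: bigcapT_measurable => i; apply: measurableC; exact: measurable_local.
Qed.

(** Integrating [admissible_closing] and using invariance gives [n] times the claim up to an error
    independent of [n]. *)
Lemma invariant_closing_le mu L : invariant_measures f mu ->
  (kappa%:E * mu (closing_set L 0) <= mu starts_none)%E.
Proof.
move=> muI.
have inv (A : nat -> set X) : (forall i, local_sets (A i)) ->
    (forall i, f @^-1` A i = A i.+1) -> forall i, mu (A i) = mu (A 0%N).
  move=> Al Af; elim=> // i <-; rewrite -Af; apply: muI; exact: measurable_local.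
have cE i : mu (closing_set L i) = mu (closing_set L 0).
  exact: (inv (closing_set L)).
have nE i : mu (none_at i) = mu starts_none by exact: (inv none_at).
have real_mu A : local_sets A -> exists2 r : R, 0 <= r & mu A = r%:E.
  move=> /measurable_local mA; exists (fine (mu A)); first by rewrite fine_ge0.
  by rewrite fineK//; exact: fin_num_measure.
have [c _ muc] := real_mu _ (local_closing L 0).
have [z z0 muz] := real_mu _ local_starts_none.
have le n : kappa * (n%:R * c) <= (n + (L + g L))%:R * z.
  have : (kappa%:E * (\sum_(i < n) mu (closing_set L i)) <=
      \sum_(i < n + (L + g L)) mu (none_at i))%E.
    apply: measure_count_le => // [i|i|x]; [exact: measurable_local..|].
    have := admissible_closing g_mono L n kappa_g kappa0 (coordinatesP (x : X)).
    rewrite !natr_sum; congr (kappa * _ <= _); apply: eq_bigr => i _; rewrite /indic.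
      by congr (_%:R); congr nat_of_bool; apply/idP/idP; rewrite inE.
    congr (_%:R); congr nat_of_bool; apply/idP/idP;
      by rewrite inE /none_at/=; case: coordinates.
  rewrite (eq_bigr _ (fun (i : 'I__) _ => cE i)) (eq_bigr _ (fun (i : 'I__) _ => nE i)).
  rewrite muc muz !sumEFin !sumr_const !card_ord -EFinM lee_fin.
  by rewrite -(mulr_natl c) -(mulr_natl z).
rewrite muc muz -EFinM lee_fin leNgt; apply/negP => lt.
have e0 : 0 < kappa * c - z by rewrite subr_gt0.
pose n := Num.bound ((L + g L)%:R * z / (kappa * c - z)).
have : (L + g L)%:R * z < n%:R * (kappa * c - z).
  by rewrite -ltr_pdivrMr// archi_boundP// divr_ge0 ?mulr_ge0// ltW.
by rewrite ltNge => /negP; apply; have := le n; rewrite natrD; nra.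
Qed.

Let eventually_some n : set X := [set x | forall i, isSome (coordinates x (n + i))].

Let eventually_some_shift n : f @^-1` eventually_some n = eventually_some n.+1.
Proof. by []. Qed.

Let measurable_eventually_some n : measurable (eventually_some n : set XB).
Proof.
elim: n => [|n IH]; first exact: measurable_never_none.
rewrite -eventually_some_shift -[X in measurable X]setTI.
exact: measurable_left_shift.
Qed.

Let eventually_some_nd : nondecreasing_seq eventually_some.
Proof.
apply/nondecreasing_seqP => n; apply/subsetPset => x xn i.
by have := xn i.+1; rewrite addSnnS.
Qed.

(** The expression in parentheses is the mass of the points with a letter at 0 and a blank later.
    These form the increasing union over [L] of the closing sets, to which [invariant_closing_le]
    applies. *)
Lemma invariant_zero_frequency mu : invariant_measures f mu ->
  (kappa%:E * (1 - mu starts_none - mu never_none) <= mu starts_none)%E.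
Proof.
move=> muI; set F := (closing_set^~ 0%N).
have mF L : measurable (F L : set XB).
  by apply: measurable_local; exact: local_closing.
have mUF : measurable (\bigcup_L F L : set XB) by exact: bigcupT_measurable.
have mZ : measurable (starts_none : set XB).
  by apply: measurable_local; exact: local_starts_none.
have mN := measurable_never_none.
have F_nd : nondecreasing_seq F.
  apply/nondecreasing_seqP => L; apply/subsetPset => x.
  rewrite /F /closing_set/= /closing => /andP[-> /existsP[l xl]]/=.
  by apply/existsP; exists (widen_ord (leqnSn L) l).
have mu1 : (mu starts_none + mu never_none + mu (\bigcup_L F L) = 1)%E.
  rewrite -measureU//; last first.
    apply/seteqP; split=> // x [x0 /(_ 0%N)]; rewrite /starts_none/= in x0.
    by rewrite x0.
  rewrite -measureU//; [|exact: measurableU|]; last first.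
    apply/seteqP; split=> // x [x0 [L _]] /andP[xs /existsP[l xl]].
    case: x0 => [x0|/(_ (0 + l)%N) xl']; last by rewrite xl' in xl.
    by rewrite x0 in xs.
  rewrite -(probability_setT mu); congr (mu _); apply/seteqP; split=> // x _.
  have [x0|] := boolP (isSome (coordinates (x : X) 0)); last first.
    by move=> x0; left; left; rewrite /starts_none/=; case: (coordinates _ _) x0.
  have [|/existsNP[l xl]] := pselect (forall i, isSome (coordinates (x : X) i)).
    by move=> xs; left; right.
  right; exists l.+1 => //; rewrite /F /closing_set/= /closing x0/=.
  by apply/existsP; exists ord_max; apply/negP.
have fin A : measurable (A : set XB) -> mu A \is a fin_num by exact: fin_num_measure.
have -> : (1 - mu starts_none - mu never_none = mu (\bigcup_L F L))%E.
  rewrite -mu1; move: (fin _ mZ) (fin _ mN) (fin _ mUF).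
  case: (mu starts_none) => // z _; case: (mu never_none) => // n _.
  by case: (mu _) => // e _; rewrite -!EFinD; congr EFin; lra.
have cvgF := nondecreasing_cvg_mu mF mUF F_nd.
have cF : (fun L => kappa%:E * mu (F L))%E @ \oo --> (kappa%:E * mu (\bigcup_L F L))%E.
  by apply: cvgeZl; last exact: cvgF.
rewrite -(cvg_lim _ cF)//; apply: lime_le; first by apply/cvg_ex; eexists; exact: cF.
by apply: nearW => L; exact: invariant_closing_le.
Qed.

(** The set [never_none] is only contained in its preimage, but the points that are eventually
    blank-free form an invariant set of the same mass. If this mass is 1, blanks have mass 0; if it
    is 0, [invariant_zero_frequency] gives the inequality. *)
Lemma ergodic_zero_frequency mu : ergodic_measures f mu ->
  let z := fine (mu starts_none) in z = 0 \/ kappa * (1 - z) <= z.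
Proof.
move=> [muI muE] z.
have mZ : measurable (starts_none : set XB).
  by apply: measurable_local; exact: local_starts_none.
have mN := measurable_never_none.
have mUN : measurable (\bigcup_n eventually_some n : set XB).
  exact: bigcupT_measurable.
have muN n : mu (eventually_some n) = mu never_none.
  by elim: n => // n IH; rewrite -eventually_some_shift muI.
have UN : mu (\bigcup_n eventually_some n) = mu never_none.
  have cN : mu \o eventually_some @ \oo --> mu (\bigcup_n eventually_some n).
    exact: nondecreasing_cvg_mu.
  have muE0 : mu \o eventually_some = cst (mu never_none).
    by apply/funext => n; exact: muN.
  by rewrite -(cvg_lim _ cN)// muE0 lim_cst.
have Zfin : mu starts_none \is a fin_num by exact: fin_num_measure.
have [|N0|N1] := muE (\bigcup_n eventually_some n) mUN.
- apply/seteqP; split=> x [n _ xn]; first by exists n.+1.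
  exists n => //; rewrite -[_ n _]/(eventually_some n.+1 x).
  by move/subsetPset : (eventually_some_nd (leqnSn n)); exact.
- right; have := invariant_zero_frequency muI.
  have -> : mu never_none = 0%E by rewrite -UN.
  by rewrite sube0 -(fineK Zfin) -EFinB -EFinM lee_fin.
- left; rewrite /z (_ : mu starts_none = 0%E)//; apply/eqP.
  rewrite -measure_le0 (le_trans (y := mu (~` never_none)))//.
    apply: le_measure; rewrite ?inE//; first exact: measurableC.
    by move=> x x0 /(_ 0%N); rewrite /starts_none/= in x0; rewrite x0.
  by rewrite probability_setC// -UN N1 subee.
Qed.

End ZeroFrequency.

(** * Periodic, ergodic and invariant measures *)

Section PeriodicMeasures.
Context {R : realType} {g : nat -> nat} {b : nat}.
Local Notation X := (gap_shift R g b).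
Local Notation f := (left_shift : X -> X).
Local Notation XB := (borel X).
Implicit Types mu : probability XB R.

Lemma measurable_shift_preimage (A : set XB) :
  measurable A -> measurable (f @^-1` A : set XB).
Proof.
by move=> mA; rewrite -[X in measurable X]setTI; exact: measurable_left_shift.
Qed.

Lemma periodic_measureE mu n (x : X) (A : set XB) :
  mu A = ((n%:R^-1)%:E * \sum_(k < n) \d_(iter k f x : XB) A)%E ->
  mu A = (n%:R^-1 * \sum_(k < n) \1_A (iter k f x))%:E.
Proof. by move=> ->; rewrite EFinM -sumEFin; congr (_ * _)%E. Qed.

Lemma periodic_measure_ergodic : periodic_measures f `<=` ergodic_measures f.
Proof.
move=> mu [n [x [n0 xn muE]]]; split.
  move=> A mA; have mfA := measurable_shift_preimage mA.
  rewrite (periodic_measureE (muE _ mA)) (periodic_measureE (muE _ mfA)).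
  congr (_ * _)%:E; case: n n0 xn {muE} => // n _ xn.
  rewrite big_ord_recr big_ord_recl/= addrC; congr (_ + _).
  rewrite /indic; congr (nat_of_bool _)%:R; rewrite -[in RHS]xn.
  by apply/idP/idP; rewrite !inE.
move=> A mA fA; rewrite (periodic_measureE (muE _ mA)).
have iterA k : \1_A (iter k f x) = \1_A x :> R.
  elim: k => // k <-; rewrite /indic; congr (nat_of_bool _)%:R.
  by rewrite -[in RHS]fA; apply/idP/idP; rewrite !inE.
under eq_bigr do rewrite iterA.
rewrite sumr_const card_ord -[\1_A x *+ n]mulr_natl mulrA.
rewrite mulVf ?mul1r ?pnatr_eq0 -?lt0n//.
by rewrite /indic; case: (_ \in _); [right|left].
Qed.

(** The mass of [starts_none] is the frequency of blanks along a period. For positive [kappa] the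
    value 0, possible for ergodic measures, is excluded. *)
Lemma periodic_zero_frequency (kappa : R) mu :
  0 <= kappa -> (forall n, kappa * n%:R <= (g n)%:R) ->
  {homo g : m n / (m <= n)%N} -> periodic_measures f mu ->
  kappa * (1 - fine (mu starts_none)) <= fine (mu starts_none).
Proof.
move=> kappa0 kappa_g g_mono [n [x [n0 xn muE]]]; set z := fine _.
have xper i : coordinates x (n + i) = coordinates x i by rewrite -iter_shiftE xn.
have := admissible_periodic_frequency g_mono kappa_g kappa0 (coordinatesP x) xper.
set c := (\sum_(i < n) isSome _)%N; set d := (\sum_(i < n) ~~ _)%N => cd.
have cdn : n%:R = c%:R + d%:R :> R.
  rewrite -natrD -big_split/= (eq_bigr (fun=> 1%N)) ?sum1_card ?card_ord// => i _.
  by case: isSome.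
have mZ : measurable (starts_none : set XB).
  by apply: measurable_local; exact: local_starts_none.
have -> : z = n%:R^-1 * d%:R.
  rewrite /z (periodic_measureE (muE _ mZ))/= natr_sum; congr (_ * _).
  apply: eq_bigr => i _; rewrite /indic; congr (nat_of_bool _)%:R.
  have := iter_shiftE i x 0; rewrite addn0 => <-.
  by apply/idP/idP; rewrite inE /starts_none/=; case: (coordinates _ _).
have nR : 0 < n%:R :> R by rewrite ltr0n.
rewrite -(ler_pM2l nR) mulrCA mulrBr mulr1 mulrA divff ?gt_eqF// mul1r.
by rewrite cdn addrK.
Qed.

End PeriodicMeasures.

(** * A blank-free ergodic measure and its mixtures with the blank point *)

Section AperiodicMeasure.
Context {R : realType} {g : nat -> nat} {b : nat}.
Local Notation X := (gap_shift R g b).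
Local Notation f := (left_shift : X -> X).
Local Notation XB := (borel X).

Lemma measurable_first_zero_parity (c : bool) :
  measurable ([set w | first_zero_parity w = c] : set binary_seq).
Proof.
suff mtrue : measurable ([set w | first_zero_parity w] : set binary_seq).
  case: c; first exact: mtrue.
  rewrite (_ : [set _ | _] = ~` [set w | first_zero_parity w]).
    exact: measurableC.
  by apply/seteqP; split=> w /=; case: first_zero_parity.
rewrite (_ : [set _ | _] = \bigcup_(r in [set r | odd r])
    [set w | residue r.+1 w = 2 ^ r - 1]%N).
  apply: bigcup_measurable => r _.
  exact: (measurable_residue r.+1 [set k | k = 2 ^ r - 1]%N).
apply/seteqP; split=> w /=; last first.
  by case=> r /= rodd /first_zero_parityP ->.
rewrite {1}/first_zero_parity; case: pselect => // ex; case: ex_minnP => r wr rmin rodd.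
exists r => //=; rewrite residueS (negbTE wr) mul0n addn0.
have := residue_odometer_carry r w.
rewrite (_ : [forall i : 'I_r, w i] = true) ?mul1n; last first.
  by apply/forallP => i; apply/negPn/negP => /rmin; rewrite leqNgt ltn_ord.
by have := ltn_residue r w; lia.
Qed.

Lemma measurable_ruler n (c : bool) :
  measurable ([set w | ruler w n = c] : set binary_seq).
Proof.
have miter : measurable_fun setT (iter n odometer : binary_seq -> binary_seq).
  elim: n => [|n IH]; first exact: measurable_id.
  exact: (measurableT_comp measurable_odometer IH).
by have := miter measurableT _ (measurable_first_zero_parity c); rewrite setTI.
Qed.

(** This map intertwines the odometer with the shift, so it carries invariant and ergodic measures
    to such measures. *)
Definition ruler_point (w : binary_seq) : X := coded (fun=> ord0) (ruler_aperiodic w).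

Lemma measurable_ruler_point : measurable_fun setT (ruler_point : binary_seq -> XB).
Proof.
apply: (@measurability _ _ binary_seq XB setT ruler_point local_sets borel_local)
  => _ [A [n nA] <-].
rewrite setTI.
pose W (u : {ffun 'I_n -> bool}) : set binary_seq :=
  \bigcap_(i in [set: 'I_n]) [set w | ruler w i = u i].
pose U := [set u | exists2 w, W u w & A (ruler_point w)].
rewrite (_ : _ @^-1` _ = \bigcup_(u in U) W u).
  apply: fin_bigcup_measurable; first exact: finite_finset.
  move=> u _; apply: fin_bigcap_measurable; first exact: finite_finset.
  by move=> i _; exact: measurable_ruler.
apply/seteqP; split=> w /=.
  move=> Aw; exists [ffun i : 'I_n => ruler w i]; last by move=> i _ /=; rewrite ffunE.
  by exists w => // i _ /=; rewrite ffunE.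
case=> u [w' uw' Aw'] uw; apply: nA Aw' => i ni /=.
by rewrite (uw' (Ordinal ni) I) -(uw (Ordinal ni) I).
Qed.

Lemma exists_ergodic_never_none : exists mu : probability XB R,
  ergodic_measures f mu /\ mu starts_none = 0%E.
Proof.
have [P P_eq] := @exists_equidistributed R.
have [mu muE] := probability_pushforward P measurable_ruler_point.
have mpre (A : set XB) :
    measurable A -> measurable (ruler_point @^-1` A : set binary_seq).
  by move=> mA; rewrite -[X in measurable X]setTI; exact: measurable_ruler_point.
have shiftE w : f (ruler_point w) = ruler_point (odometer w).
  by apply: coordinates_inj; apply/funext => i /=; rewrite /ruler add1n iterSr.
have preE (A : set XB) :
    ruler_point @^-1` (f @^-1` A) = odometer @^-1` (ruler_point @^-1` A).
  by apply/seteqP; split=> w /=; rewrite shiftE.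
exists mu; split; [split|].
- by move=> A mA; rewrite !muE preE odometer_invariant//; exact: mpre.
- move=> A mA fA; rewrite muE; apply: odometer_ergodic => //; first exact: mpre.
  by rewrite -preE fA.
- by rewrite muE (_ : _ @^-1` _ = set0) ?measure0//; apply/seteqP; split.
Qed.

(** Mix the blank-free ergodic measure, with weight [1 - z], and the Dirac mass at the fixed point
    [all_none], with weight [z]. *)
Lemma exists_invariant_zero_frequency (z : R) : 0 <= z <= 1 ->
  exists2 nu : probability XB R, invariant_measures f nu & nu starts_none = z%:E.
Proof.
move=> /andP[z0 z1]; have [mu [[muI _] muZ]] := exists_ergodic_never_none.
have t0 : 0 <= 1 - z by rewrite subr_ge0.
pose m := measure_add (mscale (NngNum t0) mu) (mscale (NngNum z0) (\d_(all_none : XB))).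
have mE A : m A = ((1 - z)%:E * mu A + z%:E * \d_(all_none : XB) A)%E.
  by rewrite /m measure_addE.
have m1 : m setT = 1%E.
  by rewrite mE probability_setT diracT !mule1 -EFinD subrK.
exists (probability_of m1).
  move=> A mA; rewrite -[LHS]/(m (f @^-1` A)) -[RHS]/(m A) !mE muI// !diracE.
  have fn : f all_none = all_none by exact: coordinates_inj.
  suff -> : ((all_none : X) \in f @^-1` A) = ((all_none : X) \in A) by [].
  by apply/idP/idP; rewrite !inE /preimage/= fn.
by rewrite -[LHS]/(m starts_none) mE muZ mule0 add0e diracE mem_set ?mule1.
Qed.

End AperiodicMeasure.

(** * The theorem *)

Section Main.
Context {R : realType} {g : nat -> nat} {b : nat}.
Local Notation X := (gap_shift R g b).
Local Notation f := (left_shift : X -> X).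
Local Notation XB := (borel X).
Variable kappa : R.
Hypothesis kappa_gt0 : 0 < kappa.
Hypothesis kappa_g : forall n, kappa * n%:R <= (g n)%:R.
Hypothesis g_mono : {homo g : m n / (m <= n)%N}.

Let kappa_ge0 : 0 <= kappa := ltW kappa_gt0.

Definition never_none_point : X := coded (fun=> ord0) (ruler_aperiodic (fun=> false)).

Lemma gap_shift_system : topological_dynamical_system f.
Proof.
split; [exact: compact_gap_shift| |exact: continuous_left_shift].
exists all_none, never_none_point => /(congr1 (fun x : X => coordinates x 0)).
by [].
Qed.

(** Blank frequency at least [kappa / (1 + kappa)] is a closed condition satisfied by all periodic
    measures and violated by the blank-free ergodic measure. *)
Lemma closure_periodic_proper :
  closure (periodic_measures f) `<` closure (ergodic_measures f).
Proof.
split; first exact/closure_subset/periodic_measure_ergodic.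
have [mu [mu_erg mu0]] := @exists_ergodic_never_none R g b.
move=> /(_ mu (subset_closure mu_erg)) mu_per.
have := closure_sub_preimage (continuous_measure_local local_starts_none)
  (@closed_ge R (kappa / (1 + kappa))) _ mu_per.
have k1 : 0 < 1 + kappa by rewrite ltr_wpDr.
rewrite /= mu0/= leNgt divr_gt0//.
move=> H; suff : false by []; apply: H => nu nu_per.
have := periodic_zero_frequency kappa_ge0 kappa_g g_mono nu_per.
by rewrite ler_pdivrMr//; lra.
Qed.

(** Ergodic measures have blank frequency 0 or at least [s], a closed condition; a mixture with
    frequency [s / 2] violates it. *)
Lemma closure_ergodic_proper :
  closure (ergodic_measures f) `<` invariant_measures f.
Proof.
split; first by apply: closure_invariant_sub => mu [].
have k1 : 0 < 1 + kappa by rewrite ltr_wpDr.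
set s := kappa / (1 + kappa); have s0 : 0 < s by rewrite divr_gt0.
have s1 : s <= 1 by rewrite ler_pdivrMr// mul1r lerDr.
have [|nu nuI nuZ] := @exists_invariant_zero_frequency R g b (s / 2); first by lra.
move=> /(_ nu nuI) nu_cl.
have := closure_sub_preimage (continuous_measure_local local_starts_none)
  (closedU (@closed_eq R 0) (@closed_ge R s)) _ nu_cl.
rewrite /= nuZ/=.
suff H : forall mu, ergodic_measures f mu ->
    ([set 0] `|` [set z | s <= z]) (fine ((mu : probability XB R) starts_none)).
  by move=> /(_ H)[]; lra.
move=> mu mu_erg; have [] := ergodic_zero_frequency kappa_ge0 kappa_g g_mono mu_erg.
  by left.
by right; rewrite /= /s ler_pdivrMr//; lra.
Qed.

(** Here [c] stands for [(1 + tau)^-1]. One half of [delta] pays for replacing [tau] by [kappa], the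
    other for the term [ln 3]; strictness uses that the entropy is positive and finite. *)
Lemma growth_lt_htop (c delta : R) : 0 < delta -> 0 <= c -> c + delta < 1 ->
  (1 + kappa)^-1 <= c + delta / 2 -> ln 3 <= delta / 2 * ln b.+1%:R ->
  (periodic_growth_rate f <= (c%:E + delta%:E) * htop f)%E /\
  ((c%:E + delta%:E) * htop f < htop f)%E.
Proof.
move=> d0 c0 cd kc b3.
have ln3 : 0 < ln 3 :> R by rewrite ln_gt0// ltr1n.
have L0 : 0 < ln b.+1%:R :> R.
  by rewrite -(pmulr_rgt0 _ (_ : 0 < delta / 2)) ?divr_gt0// (lt_le_trans ln3).
have := htop_ge (R := R) (g := g) (b := b) (ruler_aperiodic (fun=> false)).
have := @htop_lty R g b.
case: (htop f) => [h| |]//= _; rewrite lee_fin => Lh.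
have h0 : 0 < h by exact: lt_le_trans Lh.
split; last by rewrite -EFinD -EFinM lte_fin gtr_pMl.
rewrite (le_trans (periodic_growth_rate_le kappa_ge0 kappa_g g_mono))//.
rewrite -EFinD -EFinM lee_fin (le_trans (y := (c + delta) * ln b.+1%:R))//.
  have := ler_wpM2r (ltW L0) kc; lra.
by rewrite ler_wpM2l// addr_ge0// ltW.
Qed.

End Main.

Theorem theorem10 (R : realType) (tau : \bar R) (delta : R) :
  (0 < tau)%E -> 0 < delta -> (delta%:E < 1 - (1 + tau)^-1)%E ->
  exists (X : pointedMetricType R) (f : X -> X),
    [/\ topological_dynamical_system f,
        positively_expansive f,
        nonuniform_periodic_tau_specification f tau,
        closure (periodic_measures f) `<` closure (ergodic_measures f) /\
        closure (ergodic_measures f) `<` invariant_measures f &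
        (periodic_growth_rate f <= ((1 + tau)^-1 + delta%:E) * htop f)%E /\
        (((1 + tau)^-1 + delta%:E) * htop f < htop f)%E].
Proof.
move=> tau0 d0 dtau.
(* It remains to choose [g] of growth rate [tau]. The slope [kappa] is finite even for infinite
   [tau], at the cost of [delta / 2]. *)
suff [g [kappa [c [k0 kg gm [low upp [cE c0 cd kc]]]]]] :
    exists (g : nat -> nat) (kappa c : R),
    [/\ 0 < kappa, forall n, kappa * n%:R <= (g n)%:R,
        {homo g : m n / (m <= n)%N} &
    [/\ forall r, (r%:E < tau)%E -> \forall n \near \oo, r * n%:R <= (g n)%:R,
        forall r, (tau < r%:E)%E -> forall N k : nat,
          \forall n \near \oo, (g (n + N)%N + k)%:R <= r * n%:R &
    [/\ ((1 + tau)^-1)%E = c%:E, 0 <= c, c + delta < 1 &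
        (1 + kappa)^-1 <= c + delta / 2]]].
  (* The alphabet is large enough for [ln 3] to be at most [delta / 2] times [ln b.+1]. *)
  pose b := Num.truncn (expR (2 * ln 3 / delta)).
  have b3 : ln 3 <= delta / 2 * ln b.+1%:R.
    rewrite -ler_pdivrMl ?divr_gt0// invf_div mulrAC -ler_expR lnK ?posrE ?ltr0n//.
    exact/ltW/truncnS_gt.
  exists (gap_shift R g b), left_shift; split.
  - exact: gap_shift_system.
  - exact: positively_expansive_left_shift.
  - have some i : isSome (coordinates (never_none_point : gap_shift R g b) i) by [].
    exact (gap_shift_tau gm some low upp).
  - split; first exact: closure_periodic_proper k0 kg gm.
    exact: closure_ergodic_proper k0 kg gm.
  - by rewrite cE; exact: growth_lt_htop k0 kg gm _ _ d0 c0 cd kc b3.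
case: tau tau0 dtau => [t| |]//; rewrite ?lte_fin => t0.
- rewrite -EFinD inver gt_eqF ?addr_gt0// -EFinB lte_fin => dt.
  pose g n := (Num.truncn (t * n%:R)).+1.
  have tg n : t * n%:R <= (g n)%:R by exact/ltW/truncnS_gt.
  exists g, t, (1 + t)^-1; split=> //.
    move=> m n mn; rewrite ltnS le_truncn// ler_wpM2l ?ler_nat// ltW//.
  split.
  - move=> r; rewrite lte_fin => rt; apply: nearW => n.
    by rewrite (le_trans _ (tg n))// ler_wpM2r// ltW.
  - move=> r; rewrite lte_fin -subr_gt0 => tr N k.
    pose B := Num.bound ((t * N%:R + 1 + k%:R) / (r - t)).
    exists B => // n /= Bn.
    have : t * N%:R + 1 + k%:R <= n%:R * (r - t).
      rewrite -ler_pdivrMr// (le_trans (y := B%:R)) ?ler_nat//.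
      apply/ltW/archi_boundP/divr_ge0; last exact: ltW.
      by have := mulr_ge0 (ltW t0) (ler0n R N); have := ler0n R k; lra.
    have : (g (n + N)%N)%:R <= t * (n%:R + N%:R) + 1.
      rewrite /g -natr1 lerD2r natrD.
      have /truncn_itv/andP[+ _] : 0 <= t * (n%:R + N%:R).
        by rewrite mulr_ge0 ?addr_ge0// ltW.
      exact.
    by rewrite natrD; lra.
  - split=> //; [by rewrite invr_ge0 addr_ge0 ?ltW|lra|lra].
rewrite addey// invey subr0 => d1.
(* For infinite [tau] a quadratic [g] has infinite rate, and the slope [K > 2 / delta] makes
   [(1 + K)^-1] at most [delta / 2]. *)
pose K := (Num.truncn (2 / delta)).+1.
exists (fun n => (K + n) * n)%N, K%:R, 0; split=> //.
- by move=> n; rewrite -natrM ler_nat leq_mul2r leq_addr orbT.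
- by move=> m n mn; rewrite leq_mul// leq_add2l.
split=> //.
  move=> r _; exists (Num.truncn r).+1 => // n /= rn.
  rewrite natrM ler_wpM2r// (le_trans (ltW (truncnS_gt r)))// ler_nat.
  by rewrite (leq_trans rn)// leq_addl.
split=> //; first by rewrite add0r.
rewrite add0r -[delta / 2]invrK lef_pV2 ?posrE ?invr_gt0 ?divr_gt0 ?ltr_wpDl//.
by rewrite invf_div (le_trans (ltW (truncnS_gt _)))// lerDr.
Qed.
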